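(* Suppose the standing assumptions (1)–(6) listed in the context hold and, additionally, that there exists $C\ge1$ (not depending on $g$) such that $\bar\pi_{g,0}=C\,\pi_{g,0}$ for all $1\le g\le G$. Then $$\lim_{m\to\infty}\mathrm{Pow}(\mathrm{ADDOW})\ \ge\ \limsup_{m\to\infty}\mathrm{Pow}(R)$$ for any $R\in\{\mathrm{Pro1},\mathrm{Pro2},\mathrm{HZZ},\mathrm{ABH}\}$.
   Context: Setting. Fix an integer $G\ge2$. For each $m$ one tests $m$ null hypotheses split into $G$ groups of sizes $m_1,\dots,m_G$ (nondecreasing integer sequences depending on $m$, $\sum_g m_g=m$). In group $g$, $H_{g,1},\dots,H_{g,m_g}\in\{0,1\}$ are fixed ($H_{g,i}=0$: the null is true), and the $p$-values $p_{g,1},\dots,p_{g,m_g}$ are $[0,1]$-valued random variables. Let $m_{g,1}=\sum_i H_{g,i}$, $m_{g,0}=m_g-m_{g,1}$, and $U(x)=\mathbf 1\{x>0\}\min(x,1)$. All limits are as $m\to\infty$. Standing assumptions: (1) if $H_{g,i}=0$, $p_{g,i}$ is uniform on $[0,1]$; (2) if $H_{g,i}=1$, $p_{g,i}$ has c.d.f. $F_g$ (not depending on $i$ or $m$), strictly concave on $[0,1]$, with $F_g(0)=0$; (3) there are $\pi_g>0$, $\pi_{g,0}>0$ with $m_g/m\to\pi_g$, $m_{g,0}/m_g\to\pi_{g,0}$, and $\pi_{g,1}=1-\pi_{g,0}>0$, for each $g$; (4) weak dependence: for each $g$ and $t\ge0$, in probability, $\frac1{m_{g,0}}\sum_{i}\mathbf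 1\{p_{g,i}\le t,H_{g,i}=0\}\to U(t)$ and $\frac1{m_{g,1}}\sum_{i}\mathbf 1\{p_{g,i}\le t,H_{g,i}=1\}\to F_g(t)$ (no assumption on dependence across groups); (5) for each $g$ there is an estimator (random variable) $\hat\pi_{g,0}\in(0,1]$ with $\hat\pi_{g,0}\to\bar\pi_{g,0}$ in probability for some constant $\bar\pi_{g,0}\ge\pi_{g,0}$; (6) the target level satisfies $\alpha\in(\alpha^*,1)$, where $$\alpha^*=\inf_{w\in K^\infty}\frac1{\sum_g\pi_gw_g(\pi_{g,0}+\pi_{g,1}f_g(0^+))},\qquad K^\infty=\Big\{w\in\mathbb R_+^G:\sum_g\pi_g\bar\pi_{g,0}w_g\le1\Big\},$$ $f_g(0^+)=\lim_{x\to0^+}(F_g(x)-F_g(0))/x\in[0,\infty]$ (conventions $1/\infty=0$, $1/0=\infty$, $0\cdot\infty=0$). Procedures. For nondecreasing $h:[0,1]\to[0,1]$ with $h(0)=0$, $\mathcal I(h)=\sup\{u\in[0,1]:h(u)\ge u\}$. For a (possibly random) weight function $W:[0,1]\to\mathbb R_+^G$ (a vector $w$ is viewed as a constant function), $$\widehat G_W(u)=m^{-1}\sum_{g=1}^G\sum_{i=1}^{m_g}\mathbf 1\{p_{g,i}\le\alpha uW_g(u)\}.$$ If $\widehat G_W$ is nondecreasing, let $\hat u_W=\mathcal I(\widehat G_W)$ and $\mathrm{MWBH}(W)=\{(g,i):p_{g,i}\le\alpha\hat u_WW_g(\hat u_W)\}$ (set of rejected indices); for a (possibly random) weight vector $w$,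 $\mathrm{WBH}(w)=\mathrm{MWBH}(w)$. Let $\widehat K=\{w\in\mathbb R_+^G:\sum_g\frac{m_g}m\hat\pi_{g,0}w_g\le1\}$. Fix any random function $\widehat W^*:[0,1]\to\widehat K$ with $\widehat G_{\widehat W^*}(u)=\max_{w\in\widehat K}\widehat G_w(u)$ for all $u\in[0,1]$ (such a maximum exists and $\widehat G_{\widehat W^*}$ is nondecreasing; random functions are understood to be such that the quantities considered are measurable). Let $\hat\pi_0=\sum_g\frac{m_g}m\hat\pi_{g,0}$, $\hat\pi_{g,1}=1-\hat\pi_{g,0}$, $\hat w^{(1)}=(1/\hat\pi_0,\dots,1/\hat\pi_0)$, and $\hat w^{(2)}$ with $\hat w^{(2)}_g=\dfrac{\hat\pi_{g,1}}{\hat\pi_{g,0}(1-\hat\pi_0)}$ (whenever $\hat w^{(2)}$ is used it is assumed that $\hat\pi_0<1$, so that it is defined). Let $\hat u_M=\max(\hat u_{\hat w^{(1)}},\hat u_{\hat w^{(2)}})$. Then - $\mathrm{ADDOW}=\mathrm{MWBH}(\widehat W^* )$; - $\mathrm{ABH}=\mathrm{WBH}(\hat w^{(1)})$, $\mathrm{HZZ}=\mathrm{WBH}(\hat w^{(2)})$; - $\mathrm{Pro1}=\{(g,i):p_{g,i}\le\alpha\,\hat u_M\,\widehat W^*_g(\hat u_M)\}$; - $\mathrm{Pro2}=\mathrm{WBH}(\widehat W^*(\hat u_M))$. Criterion. For a procedure $R$ (random set of rejected indices) and $\mathcal H_1=\{(g,i):H_{g,i}=1\}$, $\mathrm{Pow}(R)=m^{-1}\mathbb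 E\big[|R\cap\mathcal H_1|\big]$. *)

(* Defs.v *)
From HB Require Import structures.
From mathcomp Require Import all_boot all_order all_algebra.
From mathcomp Require Import all_classical all_reals all_analysis.

Set Implicit Arguments.
Unset Strict Implicit.
Unset Printing Implicit Defensive.

Import Order.TTheory GRing.Theory Num.Theory.
Import numFieldNormedType.Exports.

Local Open Scope classical_set_scope.
Local Open Scope ring_scope.

(* Multiple testing with [G] groups: group [g] contains [n g] hypotheses, a
   hypothesis is a pair (g, i), and [H g i] holds iff the null is false.
   Procedures are defined on realized data [p], [pihat0], [W]; they become
   random sets when these data depend on an outcome [x]. *)

Definition hypothesis G (n : 'I_G -> nat) : finType := {g : 'I_G & 'I_(n g)}.

Definition ntests G (n : 'I_G -> nat) : nat := (\sum_g n g)%N.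

Definition nb_alt G (n : 'I_G -> nat) (H : forall g, 'I_(n g) -> bool)
  (g : 'I_G) : nat := (\sum_(i < n g) H g i)%N.

Definition nb_null G (n : 'I_G -> nat) (H : forall g, 'I_(n g) -> bool)
  (g : 'I_G) : nat := (n g - nb_alt H g)%N.

Definition alternatives G (n : 'I_G -> nat) (H : forall g, 'I_(n g) -> bool) :
  {set hypothesis n} := [set k : hypothesis n | H (tag k) (tagged k)]%SET.

Definition null_ecdf (R : realType) G (n : 'I_G -> nat)
    (H : forall g, 'I_(n g) -> bool) (p : forall g, 'I_(n g) -> R)
    (g : 'I_G) (t : R) : R :=
  (nb_null H g)%:R^-1 * \sum_(i < n g) ((p g i <= t) && ~~ H g i)%:R.

Definition alt_ecdf (R : realType) G (n : 'I_G -> nat)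
    (H : forall g, 'I_(n g) -> bool) (p : forall g, 'I_(n g) -> R)
    (g : 'I_G) (t : R) : R :=
  (nb_alt H g)%:R^-1 * \sum_(i < n g) ((p g i <= t) && H g i)%:R.

Definition U (R : realType) (x : R) : R := if 0 < x then Num.min x 1 else 0.

Definition strictly_concave01 (R : realType) (F : R -> R) : Prop :=
  forall x y t : R, 0 <= x <= 1 -> 0 <= y <= 1 -> x != y -> 0 < t < 1 ->
    t * F x + (1 - t) * F y < F (t * x + (1 - t) * y).

Definition cvg_in_probability d (T : measurableType d) (R : realType)
    (P : probability T R) (X : nat -> T -> R) (c : R) : Prop :=
  forall e : R, 0 < e ->
    P [set x | e <= `|X m x - c|] @[m --> \oo] --> 0%E.

Definition right_slope0 (R : realType) (F : R -> R) : \bar R :=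
  lim (((F x - F 0) / x)%:E @[x --> 0^'+]).

Definition Kinf (R : realType) G (pi pibar0 : 'I_G -> R) : set ('I_G -> R) :=
  [set w | (forall g, 0 <= w g) /\ \sum_g pi g * pibar0 g * w g <= 1].

(* On [\bar R]: 0^-1 = +oo, +oo^-1 = 0 and 0 * +oo = 0. *)
Definition alpha_star (R : realType) G (pi pi0 pibar0 : 'I_G -> R)
    (F : 'I_G -> R -> R) : \bar R :=
  ereal_inf [set ((\sum_g (pi g * w g)%R%:E *
      ((pi0 g)%:E + (1 - pi0 g)%R%:E * right_slope0 (F g)))^-1)%E
    | w in Kinf pi pibar0].

Definition crossing (R : realType) (h : R -> R) : R :=
  sup [set u | 0 <= u <= 1 /\ u <= h u].

Definition Ghat (R : realType) G (n : 'I_G -> nat) (alpha : R)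
    (p : forall g, 'I_(n g) -> R) (W : R -> 'I_G -> R) (u : R) : R :=
  (ntests n)%:R^-1 *
    \sum_g \sum_(i < n g) (p g i <= alpha * u * W u g)%R%:R.

Definition uhat (R : realType) G (n : 'I_G -> nat) (alpha : R)
    (p : forall g, 'I_(n g) -> R) (W : R -> 'I_G -> R) : R :=
  crossing (Ghat alpha p W).

Definition rejections (R : realType) G (n : 'I_G -> nat) (alpha : R)
    (p : forall g, 'I_(n g) -> R) (W : R -> 'I_G -> R) (u : R) :
    {set hypothesis n} :=
  [set k : hypothesis n |
    p (tag k) (tagged k) <= alpha * u * W u (tag k)]%SET.

Definition MWBH (R : realType) G (n : 'I_G -> nat) (alpha : R)
    (p : forall g, 'I_(n g) -> R) (W : R -> 'I_G -> R) : {set hypothesis n} :=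
  rejections alpha p W (uhat alpha p W).

Definition WBH (R : realType) G (n : 'I_G -> nat) (alpha : R)
    (p : forall g, 'I_(n g) -> R) (w : 'I_G -> R) : {set hypothesis n} :=
  MWBH alpha p (fun=> w).

Definition Khat (R : realType) G (n : 'I_G -> nat) (pihat0 : 'I_G -> R) :
    set ('I_G -> R) :=
  [set w | (forall g, 0 <= w g) /\
    \sum_g (n g)%:R / (ntests n)%:R * pihat0 g * w g <= 1].

Definition optimal_weights (R : realType) G (n : 'I_G -> nat) (alpha : R)
    (p : forall g, 'I_(n g) -> R) (pihat0 : 'I_G -> R)
    (W : R -> 'I_G -> R) : Prop :=
  forall u : R, 0 <= u <= 1 ->
    Khat n pihat0 (W u) /\
    forall w, Khat n pihat0 w -> Ghat alpha p (fun=> w) u <= Ghat alpha p W u.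

Definition pihat0_mean (R : realType) G (n : 'I_G -> nat)
    (pihat0 : 'I_G -> R) : R :=
  \sum_g (n g)%:R / (ntests n)%:R * pihat0 g.

Definition what1 (R : realType) G (n : 'I_G -> nat) (pihat0 : 'I_G -> R)
    (g : 'I_G) : R :=
  (pihat0_mean n pihat0)^-1.

Definition what2 (R : realType) G (n : 'I_G -> nat) (pihat0 : 'I_G -> R)
    (g : 'I_G) : R :=
  (1 - pihat0 g) / (pihat0 g * (1 - pihat0_mean n pihat0)).

Definition uhatM (R : realType) G (n : 'I_G -> nat) (alpha : R)
    (p : forall g, 'I_(n g) -> R) (pihat0 : 'I_G -> R) : R :=
  Num.max (uhat alpha p (fun=> what1 n pihat0))
          (uhat alpha p (fun=> what2 n pihat0)).

Definition ADDOW (R : realType) G (n : 'I_G -> nat) (alpha : R)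
    (p : forall g, 'I_(n g) -> R) (W : R -> 'I_G -> R) : {set hypothesis n} :=
  MWBH alpha p W.

Definition ABH (R : realType) G (n : 'I_G -> nat) (alpha : R)
    (p : forall g, 'I_(n g) -> R) (pihat0 : 'I_G -> R) : {set hypothesis n} :=
  WBH alpha p (what1 n pihat0).

Definition HZZ (R : realType) G (n : 'I_G -> nat) (alpha : R)
    (p : forall g, 'I_(n g) -> R) (pihat0 : 'I_G -> R) : {set hypothesis n} :=
  WBH alpha p (what2 n pihat0).

Definition Pro1 (R : realType) G (n : 'I_G -> nat) (alpha : R)
    (p : forall g, 'I_(n g) -> R) (pihat0 : 'I_G -> R)
    (W : R -> 'I_G -> R) : {set hypothesis n} :=
  rejections alpha p W (uhatM alpha p pihat0).

Definition Pro2 (R : realType) G (n : 'I_G -> nat) (alpha : R)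
    (p : forall g, 'I_(n g) -> R) (pihat0 : 'I_G -> R)
    (W : R -> 'I_G -> R) : {set hypothesis n} :=
  WBH alpha p (W (uhatM alpha p pihat0)).

Definition random_set d (T : measurableType d) (K : finType)
    (A : T -> {set K}) : Prop :=
  forall k : K, measurable [set x | k \in A x].

Definition Pow d (T : measurableType d) (R : realType) (P : probability T R)
    G (n : 'I_G -> nat) (H : forall g, 'I_(n g) -> bool)
    (A : T -> {set hypothesis n}) : \bar R :=
  ((ntests n)%:R^-1%:E *
    'E_P[fun x => #|A x :&: alternatives H|%SET%:R : R])%E.

(* Main.v *)
Require Import Defs.
From HB Require Import structures.
From mathcomp Require Import all_boot all_order all_algebra.
From mathcomp Require Import all_classical all_reals all_analysis.
From mathcomp Require Import measurable_realfun ring lra.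

Set Implicit Arguments.
Unset Strict Implicit.
Unset Printing Implicit Defensive.

Import Order.TTheory GRing.Theory Num.Theory.
Import numFieldNormedType.Exports.

Local Open Scope classical_set_scope.
Local Open Scope ring_scope.

(** Let [M s] be the largest limiting proportion of rejections over thresholds
    [t] with [\sum_g C pi_g pi0_g t_g <= alpha s].  Since [pibar0 = C pi0], the
    budget constraint bounds exactly the limiting proportion of false
    discoveries, so among thresholds of budget [s] the largest power is
    [M s - min (alpha s / C) (\sum_g pi_g pi0_g)].  ADDOW stops at a point [uh]
    converging to the last [u] with [u <= M u], rejects a proportion at least
    [uh], and its null part obeys the same bound; hence its power converges to
    [u - min (alpha u / C) (\sum_g pi_g pi0_g)].  The other procedures use
    weights of [Khat] at some point [<= uh], so they have no larger budget.
    The argument runs on an event of probability close to 1, on which the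
    empirical quantities are uniformly close to their limits. *)

(** The weights are an arbitrary random maximizer, with no uniqueness or convergence at hand. Hence
    weights are never compared with each other: only budgets and attained rates are, and every
    estimate is uniform in the threshold vector. What makes this possible is that [U t = t] on
    [[0, 1]]: once thresholds are capped at [1], the null rate is the linear cost divided by [C], so
    more total discoveries at an exhausted budget means more true ones. A later stopping point never
    harms the limiting power, because [alpha / C < 1] makes the null part grow more slowly than [u].
    The empirical crossing is stable because [value s / s] is nonincreasing, stays above [1] before
    the crossing by strict concavity of the [F g], and stays below [1] after it. *)

Section concave_cdf.
Context {R : realType}.
Implicit Types (phi psi : R -> R) (x y r t : R).

(** One interface for [U] and for every [F g], so that null and alternative rates share their
    lemmas. Concavity is asked on the whole half-line because the thresholds [alpha * u * w g] may
    exceed [1]. The last field is right continuity at [0]: no jump there. *)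
Record concave_cdf phi : Prop := ConcaveCdf {
  concdf0 : phi 0 = 0;
  concdf_eq1 : forall t, 1 <= t -> phi t = 1;
  concdf_homo : forall x y, 0 <= x -> x <= y -> phi x <= phi y;
  concdf_concave : forall x y t, 0 <= x -> 0 <= y -> 0 <= t <= 1 ->
    t * phi x + (1 - t) * phi y <= phi (t * x + (1 - t) * y);
  concdf_small : forall e, 0 < e -> exists2 h, 0 < h & phi h < e }.

Lemma concdf_ge0 phi t : concave_cdf phi -> 0 <= t -> 0 <= phi t.
Proof. by move=> cphi t0; rewrite -(concdf0 cphi); exact: concdf_homo. Qed.

Lemma concdf_le1 phi t : concave_cdf phi -> 0 <= t -> phi t <= 1.
Proof.
move=> cphi t0; have [t1|/ltW t1] := leP 1 t; first by rewrite concdf_eq1.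
by rewrite -(concdf_eq1 cphi (lexx 1)); exact: concdf_homo.
Qed.

Lemma concdf_clip phi t : concave_cdf phi -> phi (Num.min t 1) = phi t.
Proof.
by move=> cphi; case: (leP t 1) => // /ltW t1; rewrite !(concdf_eq1 cphi).
Qed.

Lemma concdf_scale phi r x : concave_cdf phi -> 0 <= r <= 1 -> 0 <= x ->
  r * phi x <= phi (r * x).
Proof.
move=> cphi r01 x0; have := concdf_concave cphi x0 (lexx 0) r01.
by rewrite (concdf0 cphi) !mulr0 !addr0.
Qed.

(** Both [x] and [y] are fractions of [x + y], and these fractions add up to [1], so two uses of
    [concdf_scale] at [x + y] suffice. *)
Lemma concdf_subadd phi x y : concave_cdf phi -> 0 <= x -> 0 <= y ->
  phi (x + y) <= phi x + phi y.
Proof.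
move=> cphi x0 y0; have [xy0|xy0] := eqVneq (x + y) 0.
  have x_0 : x = 0 by lra.
  have y_0 : y = 0 by lra.
  by rewrite x_0 y_0 addr0 (concdf0 cphi) addr0.
have xy_gt0 : 0 < x + y by rewrite lt_def xy0 addr_ge0.
have ge0_le1 z : 0 <= z -> z <= x + y -> 0 <= z / (x + y) <= 1.
  by move=> z0 zxy; rewrite divr_ge0 ?addr_ge0//= ler_pdivrMr// mul1r.
have s0 : 0 <= x + y by exact: ltW.
have := concdf_scale cphi (ge0_le1 x x0 _) s0.
have := concdf_scale cphi (ge0_le1 y y0 _) s0.
rewrite !divfK// lerDl lerDr => /(_ x0) hy /(_ y0) hx.
have -> : phi (x + y) = x / (x + y) * phi (x + y) + y / (x + y) * phi (x + y).
  by rewrite -mulrDl -mulrDl divff// mul1r.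
exact: lerD.
Qed.

(* The points [r y, x] and [r x, y] have the same [r]-weighted sum, and the
   former lie between the latter. *)
Lemma concdf_gap_homo phi r x y : concave_cdf phi -> 0 <= r < 1 ->
  0 <= x -> x <= y -> phi (r * x) - r * phi x <= phi (r * y) - r * phi y.
Proof.
move=> cphi /andP[r0 r1] x0 xy.
have [y_0|y0] := eqVneq y 0.
  by have -> : x = y by lra.
have y_gt0 : 0 < y by rewrite lt_def y0 (le_trans x0).
have d_gt0 : 0 < y - r * x by nra.
set d := y - r * x in d_gt0 *.
have d0 : d != 0 by rewrite gt_eqF.
have rx0 : 0 <= r * x by exact: mulr_ge0.
have y_ge0 : 0 <= y by exact: ltW.
(* Coordinates on the segment from [r * x] to [y]: [l] locates [r * y] and [k] locates [x]. Since
   [l + r * k = 1], the first concavity inequality plus [r] times the second leaves exactly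
   [phi (r * x) + r * phi y]. *)
pose l := y * (1 - r) / d; pose k := (y - x) / d.
have l01 : 0 <= l <= 1.
  apply/andP; split; first by apply: divr_ge0; [nra|exact: ltW].
  by rewrite ler_pdivrMr// mul1r /d; nra.
have k01 : 0 <= k <= 1.
  apply/andP; split; first by apply: divr_ge0; [lra|exact: ltW].
  by rewrite ler_pdivrMr// mul1r /d; nra.
have := concdf_concave cphi rx0 y_ge0 l01.
have := concdf_concave cphi rx0 y_ge0 k01.
have -> : k * (r * x) + (1 - k) * y = x.
  by rewrite /k; move: d0; rewrite /d => d0; field.
have -> : l * (r * x) + (1 - l) * y = r * y.
  by rewrite /l; move: d0; rewrite /d => d0; field.
have lk : l + r * k = 1.
  by rewrite /l /k; move: d0; rewrite /d => d0; field.
have -> : l = 1 - r * k by lra.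
nra.
Qed.

(* By subadditivity and concavity, [phi] increases by at most [phi k^-1]
   between two consecutive points [j / k] of the grid. *)
Lemma polya phi e : concave_cdf phi -> 0 < e ->
  exists k : nat, forall psi,
    {homo psi : x y / x <= y} -> (forall t, psi t <= 1) ->
    (forall j : 'I_k.+1, `|psi (j%:R / k%:R) - phi (j%:R / k%:R)| < e) ->
    forall t, 0 <= t -> `|psi t - phi t| <= 2 * e.
Proof.
move=> cphi e0; have [h h0 phih] := concdf_small cphi e0.
pose k := (Num.truncn h^-1).+1; exists k => psi psi_homo psi_le1 grid t t0.
have k0 : 0 < k%:R :> R by rewrite ltr0n.
have kh : k%:R^-1 <= h.
  rewrite -[leRHS]invrK lef_pV2 ?posrE ?invr_gt0//.
  by rewrite ltW// truncnS_gt.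
have step x : 0 <= x -> phi (x + k%:R^-1) <= phi x + e.
  move=> x0; apply: le_trans (concdf_subadd cphi x0 _) _.
    by rewrite invr_ge0 ltW.
  rewrite lerD2l (le_trans _ (ltW phih))//.
  by apply: (concdf_homo cphi) => //; rewrite invr_ge0 ltW.
(* Past [1] monotonicity bounds [psi] only from below, by its value at the last node [k / k]; the
   upper bound is [psi t <= 1]. *)
have [t1|t1] := leP 1 t.
  have := grid ord_max; rewrite /= divff ?gt_eqF// (concdf_eq1 cphi (lexx _)).
  rewrite (concdf_eq1 cphi t1) => /ltr_normlP[? ?].
  have := psi_homo _ _ t1; have := psi_le1 t.
  by move=> ? ?; rewrite ler_norml; apply/andP; split; lra.
pose j := Num.truncn (t * k%:R).
have tk0 : 0 <= t * k%:R by rewrite mulr_ge0// ltW.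
have /andP[jt tj] := truncn_itv tk0.
have jk : (j < k)%N.
  rewrite -(ltr_nat R) (le_lt_trans jt)//.
  by rewrite -[ltRHS]mul1r ltr_pM2r.
have jt' : j%:R / k%:R <= t by rewrite ler_pdivrMr.
have tj' : t <= j.+1%:R / k%:R by rewrite ler_pdivlMr// ltW.
have j0 : 0 <= j%:R / k%:R :> R by rewrite divr_ge0// ltW.
have Sj : j.+1%:R / k%:R = j%:R / k%:R + k%:R^-1 :> R.
  by rewrite -natr1 mulrDl mul1r.
have /ltr_normlP[g1 g2] := grid (Ordinal (ltnW jk : (j < k.+1)%N)).
have /ltr_normlP[g3 g4] := grid (Ordinal (jk : (j.+1 < k.+1)%N)).
rewrite /= in g1 g2 g3 g4.
have := psi_homo _ _ jt'; have := psi_homo _ _ tj'.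
have := concdf_homo cphi j0 jt'; have := concdf_homo cphi t0 tj'.
have := step _ j0; rewrite -Sj => *.
by rewrite ler_norml; apply/andP; split; lra.
Qed.

Lemma U_id t : 0 <= t <= 1 -> U t = t.
Proof.
move=> /andP[t0 t1]; rewrite /U; case: ltgtP t0 => // _ _.
by rewrite min_l.
Qed.

Lemma U_min t : 0 <= t -> U t = Num.min t 1.
Proof.
move=> t0; rewrite /U; case: ltgtP t0 => // <- _.
by rewrite min_l.
Qed.

Lemma concave_cdf_U : concave_cdf (@U R).
Proof.
split => [|t t1|x y x0 xy|x y t x0 y0 /andP[t0 t1]|e e0].
- by rewrite /U ltxx.
- by rewrite U_min ?(le_trans ler01)// min_r.
- have y0 : 0 <= y by exact: le_trans xy.
  rewrite !U_min//.
  by case: (leP x 1); case: (leP y 1) => *; lra.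
- have c0 : 0 <= t * x + (1 - t) * y by nra.
  rewrite !U_min// le_min.
  by apply/andP; split; case: (leP x 1); case: (leP y 1) => *; nra.
- exists (Num.min (e / 2) 1); first by rewrite lt_min ltr01 divr_gt0.
  have m0 : 0 <= Num.min (e / 2) 1 by rewrite le_min ler01 divr_ge0// ltW.
  rewrite U_min// !gt_min; apply/orP; left; apply/orP; left.
  lra.
Qed.

End concave_cdf.

Lemma finite_lower_bound (R : realType) G (f : 'I_G -> R) :
  (forall g, 0 < f g) -> exists2 c, 0 < c & forall g, c <= f g.
Proof.
move=> f0; exists (\big[Num.min/1]_g f g).
  by apply: (big_ind (fun c => 0 < c)) => // x y x0 y0; rewrite lt_min x0.
move=> g; rewrite (bigD1 g)//= ge_min lexx//.
Qed.

(** * The limiting problem: best discovery rate for a given budget, and its crossing with the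
    diagonal *)

Section value_function.
Context {R : realType} {G : nat}.
Variables (F : 'I_G -> R -> R) (a0 a1 : 'I_G -> R) (C alpha : R).
Hypothesis F_concdf : forall g, concave_cdf (F g).
Hypothesis F_strict : forall g (x r : R), 0 < x -> 0 < r < 1 ->
  r * F g x < F g (r * x).
Hypotheses (a0_gt0 : forall g, 0 < a0 g) (a1_gt0 : forall g, 0 < a1 g).
Hypothesis a01 : \sum_g a0 g + \sum_g a1 g = 1.
Hypotheses (C_ge1 : 1 <= C) (alpha_gt0 : 0 < alpha) (alpha_lt1 : alpha < 1).
Implicit Types (t w : 'I_G -> R) (s u r : R).

Definition null_rate t := \sum_g a0 g * U (t g).
Definition alt_rate t := \sum_g a1 g * F g (t g).
Definition total_rate t := null_rate t + alt_rate t.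

(** With [a0 g = pi g * pi0 g], these are the thresholds [alpha * s * w g] for [w] in [Kinf].
    Thresholds rather than weights make the budget scale linearly in [s]. *)
Definition feasible s t :=
  (forall g, 0 <= t g) /\ \sum_g C * a0 g * t g <= alpha * s.

Definition value s := sup [set total_rate t | t in feasible s].

(** The largest power at budget [s], with [value s] replaced by [s]; both agree at the crossing.
    This form is monotone and 1-Lipschitz, so only the stopping point has to be located. *)
Definition net s := s - Num.min (alpha * s / C) (\sum_g a0 g).

(** Coefficients and profiles are left arbitrary to serve both pairs, [a0] with [U] and [a1] with
    [F]. *)
Lemma rate_scale (c : 'I_G -> R) (phi : 'I_G -> R -> R) t r :
  (forall g, 0 < c g) -> (forall g, concave_cdf (phi g)) ->
  (forall g, 0 <= t g) -> 0 <= r <= 1 ->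
  r * (\sum_g c g * phi g (t g)) <= \sum_g c g * phi g (r * t g).
Proof.
move=> c0 cphi t0 r01; rewrite mulr_sumr; apply: ler_sum => g _.
by rewrite mulrCA ler_wpM2l ?(ltW (c0 g))//; exact: concdf_scale.
Qed.

Lemma rate_le_sum (c : 'I_G -> R) (phi : 'I_G -> R -> R) t :
  (forall g, 0 < c g) -> (forall g, concave_cdf (phi g)) ->
  (forall g, 0 <= t g) -> \sum_g c g * phi g (t g) <= \sum_g c g.
Proof.
move=> c0 cphi t0; apply: ler_sum => g _.
by rewrite ler_piMr ?(ltW (c0 g))//; exact: concdf_le1.
Qed.

Lemma rate_homo (c : 'I_G -> R) (phi : 'I_G -> R -> R) t t' :
  (forall g, 0 < c g) -> (forall g, concave_cdf (phi g)) ->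
  (forall g, 0 <= t g) -> (forall g, t g <= t' g) ->
  \sum_g c g * phi g (t g) <= \sum_g c g * phi g (t' g).
Proof.
move=> c0 cphi t0 tt'; apply: ler_sum => g _.
by rewrite ler_wpM2l ?(ltW (c0 g))//; exact: concdf_homo.
Qed.

Lemma rate_ge0 (c : 'I_G -> R) (phi : 'I_G -> R -> R) t :
  (forall g, 0 < c g) -> (forall g, concave_cdf (phi g)) ->
  (forall g, 0 <= t g) -> 0 <= \sum_g c g * phi g (t g).
Proof.
move=> c0 cphi t0; apply: sumr_ge0 => g _.
by rewrite mulr_ge0 ?(ltW (c0 g))//; exact: concdf_ge0.
Qed.

Lemma total_rate_scale t r : (forall g, 0 <= t g) -> 0 <= r <= 1 ->
  r * total_rate t <= total_rate (fun g => r * t g).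
Proof.
move=> t0 r01; rewrite mulrDr; apply: lerD.
  by apply: (rate_scale a0_gt0 (fun=> concave_cdf_U)).
exact: rate_scale.
Qed.

Lemma total_rate_le1 t : (forall g, 0 <= t g) -> total_rate t <= 1.
Proof.
move=> t0; rewrite -a01; apply: lerD; last exact: rate_le_sum.
exact: (rate_le_sum a0_gt0 (fun=> concave_cdf_U)).
Qed.

Let C_gt0 : 0 < C. Proof. exact: lt_le_trans C_ge1. Qed.

Lemma feasible_scale r s t : 0 <= r -> feasible s t ->
  feasible (r * s) (fun g => r * t g).
Proof.
move=> r0 [t0 ts]; split => [g|]; first exact: mulr_ge0.
rewrite (eq_bigr (fun g => r * (C * a0 g * t g))) => [|g _]; last by ring.
by rewrite -mulr_sumr mulrCA ler_wpM2l.
Qed.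

Lemma feasible0 s : 0 <= s -> feasible s (fun=> 0).
Proof.
move=> s0; split => // .
by rewrite big1 ?mulr_ge0 ?(ltW alpha_gt0)// => g _; rewrite mulr0.
Qed.

Lemma value_ge s t : feasible s t -> total_rate t <= value s.
Proof.
move=> st; apply: ub_le_sup; last by exists t.
by exists 1 => _ [t' [t'0 _] <-]; exact: total_rate_le1.
Qed.

Lemma value_le s c : 0 <= s ->
  (forall t, feasible s t -> total_rate t <= c) -> value s <= c.
Proof.
move=> s0 sc; apply: ge_sup; last by move=> _ [t st <-]; exact: sc.
by exists (total_rate (fun=> 0)), (fun=> 0) => //; exact: feasible0.
Qed.

Lemma value_gt s c : 0 <= s -> c < value s ->
  exists2 t, feasible s t & c < total_rate t.
Proof.
move=> s0 /sup_gt; case=> [|_ [t st <-]]; last by exists t.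
by exists (total_rate (fun=> 0)), (fun=> 0) => //; exact: feasible0.
Qed.

Lemma value_le1 s : 0 <= s -> value s <= 1.
Proof. by move=> s0; apply: value_le => // t [t0 _]; exact: total_rate_le1. Qed.

Lemma value_homo s s' : 0 <= s -> s <= s' -> value s <= value s'.
Proof.
move=> s0 ss'; apply: value_le => // t [t0 st]; apply: value_ge; split => //.
by rewrite (le_trans st)// ler_wpM2l// ltW.
Qed.

(** Shrinking thresholds by [r] shrinks the cost by [r] and, by concavity from [0], the rate by no
    more. Thus [value s / s] is nonincreasing. *)
Lemma value_scale r s : 0 <= r <= 1 -> 0 <= s ->
  r * value s <= value (r * s).
Proof.
move=> r01 s0; have /andP[r0 r1] := r01.
have [->|r_neq0] := eqVneq r 0.
  rewrite !mul0r; apply: le_trans (value_ge (feasible0 (lexx 0))).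
  apply: addr_ge0; last exact: rate_ge0.
  exact: (rate_ge0 _ (fun=> concave_cdf_U)).
have r_gt0 : 0 < r by rewrite lt_def r_neq0.
rewrite mulrC -ler_pdivlMr//; apply: value_le => // t st.
rewrite ler_pdivlMr// mulrC.
apply: le_trans (value_ge (feasible_scale r0 st)).
by apply: total_rate_scale => //; case: st.
Qed.

(* Some coordinate of a nearly optimal [t] stays away from [0], which gives
   a gain in the strict concavity of [F] that is uniform in [t]. *)
Lemma value_scale_strict r s : 0 < r < 1 -> 0 < s -> s <= value s ->
  r * s < value (r * s).
Proof.
move=> /andP[r0 r1] s0 sv.
have s4 : 0 < s / 4 by rewrite divr_gt0.
(* If all thresholds were below [x], the total rate would be at most [s / 4], too small for a
   near-optimal [t]. *)
have [x x0 xs] : exists2 x : R, 0 < x &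
    U x <= s / 4 /\ forall g, F g x <= s / 4.
  have [hU hU0 hUs] := concdf_small (@concave_cdf_U R) s4.
  have /choice[h hP] : forall g, exists h, 0 < h /\ F g h < s / 4.
    by move=> g; have [h h0 hs] := concdf_small (F_concdf g) s4; exists h.
  have [c c0 ch] := finite_lower_bound (fun g => (hP g).1).
  exists (Num.min hU c); first by rewrite lt_min hU0.
  have m0 : 0 <= Num.min hU c by rewrite le_min !ltW.
  split.
    apply: le_trans (ltW hUs); apply: (concdf_homo concave_cdf_U) => //.
    by rewrite ge_min lexx.
  move=> g; apply: le_trans (ltW (hP g).2).
  apply: (concdf_homo (F_concdf g)) => //.
  by rewrite ge_min ch orbT.
have [c c0 cP] : exists2 c : R, 0 < c &
    forall g, c <= a1 g * (F g (r * x) - r * F g x).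
  apply: finite_lower_bound => g; rewrite mulr_gt0// subr_gt0.
  by apply: F_strict; rewrite ?r0.
(* The suboptimality [e] leaves a rate of at least [s / 2 > s / 4], and the loss [r * e] stays below
   the gain [c]. *)
pose e := Num.min (s / 2) (c / 2).
have e0 : 0 < e by rewrite lt_min !divr_gt0.
have es : e <= s / 2 by rewrite ge_min lexx.
have ec : e <= c / 2 by rewrite ge_min lexx orbT.
have [t st tv] : exists2 t, feasible s t & s - e < total_rate t.
  by apply: value_gt; [exact: ltW|lra].
have t0 := st.1.
have [g xt] : exists g, x <= t g.
  apply/not_existsP => tx.
  have tx' g : t g <= x by have /negP := tx g; rewrite -ltNge => /ltW.
  have : total_rate t <= s / 4.
    rewrite -[leRHS]mul1r -[X in X * _]a01 mulrDl !mulr_suml.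
    apply: lerD; apply: ler_sum => g _.
      rewrite ler_wpM2l ?(ltW (a0_gt0 g))//.
      by apply: le_trans xs.1; exact: (concdf_homo concave_cdf_U).
    rewrite ler_wpM2l ?(ltW (a1_gt0 g))//.
    by apply: le_trans (xs.2 g); exact: (concdf_homo (F_concdf g)).
  lra.
have r01 : 0 <= r <= 1 by rewrite !ltW.
apply: lt_le_trans (value_ge (feasible_scale (ltW r0) st)).
suff : r * total_rate t + c <= total_rate (fun g => r * t g).
  have : r * (s - e) <= r * total_rate t by rewrite ler_pM2l// ltW.
  have : r * e <= e by rewrite ler_piMl ?ltW.
  by lra.
rewrite mulrDr -addrA; apply: lerD.
  by apply: (rate_scale a0_gt0 (fun=> concave_cdf_U)).
rewrite /alt_rate (bigD1 g)//= [leRHS](bigD1 g)//= mulrDr addrAC.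
apply: lerD.
  (* The gap [F g (r * y) - r * F g y] is nondecreasing in [y], so the gain computed at [x] is still
     available at [t g]. *)
  apply: le_trans (lerD (lexx _) (cP g)) _.
  have r01' : 0 <= r < 1 by rewrite ltW.
  have := concdf_gap_homo (F_concdf g) r01' (ltW x0) xt.
  by rewrite -(ler_pM2l (a1_gt0 g)); lra.
rewrite mulr_sumr; apply: ler_sum => k _.
by rewrite mulrCA ler_wpM2l ?(ltW (a1_gt0 k))//; exact: concdf_scale.
Qed.

Notation ustar := (crossing value).

Let crossing0 : [set u | 0 <= u <= 1 /\ u <= value u] 0.
Proof.
split; first by rewrite lexx ler01.
have z01 : 0 <= (0 : R) <= 1 by rewrite lexx ler01.
by have := value_scale z01 (lexx 0); rewrite !mul0r.
Qed.

Lemma ustar_ub u : 0 <= u <= 1 -> u <= value u -> u <= ustar.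
Proof.
move=> u01 uv; apply: ub_le_sup => //.
by exists 1 => v /= [/andP[]].
Qed.

Lemma ustar_itv : 0 <= ustar <= 1.
Proof.
rewrite ustar_ub ?crossing0.2 ?lexx ?ler01//=.
by apply: ge_sup; [by exists 0|by move=> v /= [/andP[]]].
Qed.

(** Monotonicity makes the supremum attained: each [v] of the set satisfies
    [v <= value v <= value ustar]. *)
Lemma value_ustar : ustar <= value ustar.
Proof.
apply: ge_sup; first by exists 0.
move=> v /= [v01 vv]; apply: (le_trans vv); apply: value_homo.
  by case/andP: v01.
exact: ustar_ub.
Qed.

(** The strict margin prevents an empirical crossing from stopping early: a perturbation smaller
    than it cannot undo the inequality. *)
Lemma value_below u : 0 < u -> u < ustar -> u < value u.
Proof.
move=> u0 us; have s0 : 0 < ustar by exact: lt_trans us.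
have -> : u = u / ustar * ustar by rewrite divfK// gt_eqF.
apply: value_scale_strict => //; last exact: value_ustar.
by rewrite divr_gt0//= ltr_pdivrMr// mul1r.
Qed.

Lemma value_above u : ustar < u <= 1 -> value u < u.
Proof.
move=> /andP[su u1]; have u01 : 0 <= u <= 1.
  by rewrite u1 andbT (le_trans _ (ltW su))//; case/andP: ustar_itv.
by rewrite ltNge; apply/negP => /(ustar_ub u01); rewrite leNgt su.
Qed.

(** The gap at [b = ustar + e] propagates to the right: as [value s / s] is nonincreasing,
    [u - value u >= (u / b) * (b - value b)]. *)
Lemma value_above_gap e : 0 < e -> exists2 h, 0 < h &
  forall u, ustar + e <= u <= 1 -> value u <= u - h.
Proof.
move=> e0; have /andP[s0 s1] := ustar_itv.
set b := ustar + e; have b0 : 0 < b by rewrite ltr_wpDl.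
have [b1|b1] := leP b 1; last first.
  (* Here no [u] lies in the range, so any [h] will do. *)
  by exists 1 => // u /andP[bu u1]; have := lt_le_trans b1 bu; rewrite ltNge u1.
have vb : value b < b by apply: value_above; rewrite b1 ltrDl e0.
exists (b - value b); first by rewrite subr_gt0.
move=> u /andP[bu u1]; have u0 : 0 < u by exact: lt_le_trans bu.
have bu01 : 0 <= b / u <= 1.
  by rewrite divr_ge0 ?(ltW b0) ?(ltW u0)//= ler_pdivrMr// mul1r.
have := value_scale bu01 (ltW u0); rewrite divfK ?gt_eqF// => bv.
have : value b < b * 1 by rewrite mulr1.
have : b * value u <= value b * u by rewrite -ler_pdivrMr// mulrAC.
nra.
Qed.

Lemma value_min e : 0 < e ->
  value (Num.min (ustar + e) 1) <= Num.min (ustar + e) 1.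
Proof.
move=> e0; case: (leP (ustar + e) 1) => [b1|_]; last exact: value_le1.
by apply/ltW/value_above; rewrite ltrDl e0.
Qed.

(** The subtracted minimum has slope at most [alpha / C < 1], so it grows no faster than [s]. *)
Lemma net_homo s s' : s <= s' -> net s <= net s'.
Proof.
move=> ss'; suff : Num.min (alpha * s' / C) (\sum_g a0 g) <=
    Num.min (alpha * s / C) (\sum_g a0 g) + (s' - s) by rewrite /net; lra.
have : alpha * s' / C <= alpha * s / C + (s' - s).
  rewrite -lerBlDl -mulrBl -mulrBr ler_pdivrMr//.
  rewrite mulrC ler_wpM2l ?subr_ge0//.
  by apply: ltW; exact: lt_le_trans alpha_lt1 C_ge1.
case: (leP (alpha * s' / C) (\sum_g a0 g));
  by case: (leP (alpha * s / C) (\sum_g a0 g)) => *; lra.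
Qed.

Lemma net_lipschitz s s' : s <= s' -> net s' <= net s + (s' - s).
Proof.
move=> ss'; have : alpha * s / C <= alpha * s' / C.
  by rewrite ler_pM2r ?invr_gt0// ler_pM2l.
rewrite /net.
case: (leP (alpha * s' / C) (\sum_g a0 g));
  by case: (leP (alpha * s / C) (\sum_g a0 g)) => *; lra.
Qed.

(* Raising the thresholds toward [1] until the null part saturates its bound
   only increases the number of true discoveries. *)
Lemma alt_rate_le s t : 0 <= s -> feasible s t ->
  alt_rate t <= value s - Num.min (alpha * s / C) (\sum_g a0 g).
Proof.
move=> s0 [t0 st]; set m := Num.min _ _.
pose q := \sum_g a0 g; pose z := \sum_g a0 g * Num.min (t g) 1.
have min0 g : 0 <= Num.min (t g) 1 by rewrite le_min t0 ler01.
have min1 g : Num.min (t g) 1 <= 1 by rewrite ge_min lexx orbT.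
have zq : z <= q.
  by apply: ler_sum => g _; rewrite ler_piMr// ltW.
have zm : z <= m.
  rewrite le_min zq andbT ler_pdivlMr// mulrC mulr_sumr (le_trans _ st)//.
  apply: ler_sum => g _.
  rewrite mulrA ler_wpM2l ?mulr_ge0 ?(ltW C_gt0) ?(ltW (a0_gt0 g))//.
  by rewrite ge_min lexx.
have mq : m <= q by rewrite ge_min lexx orbT.
(* Linear interpolation between the null mass [z] of the capped thresholds and the mass [q] of
   thresholds all equal to [1], set to hit [m]. If [z = q], then [m] equals both. *)
have [l /andP[l0 l1] lP] : exists2 l, 0 <= l <= 1 & (1 - l) * z + l * q = m.
  have [zq_eq|zq_neq] := eqVneq z q.
    by exists 0; rewrite ?lexx ?ler01//; lra.
  have zq_lt : 0 < q - z by rewrite subr_gt0 lt_neqAle zq_neq.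
  exists ((m - z) / (q - z)); last by field; rewrite gt_eqF.
  by rewrite divr_ge0 ?ler_pdivrMr ?mul1r//=; lra.
pose t' g := (1 - l) * Num.min (t g) 1 + l.
have t'0 g : 0 <= t' g by rewrite addr_ge0// mulr_ge0// subr_ge0.
have t'1 g : t' g <= 1 by have := min1 g; rewrite /t'; nra.
have sum_t' : \sum_g a0 g * t' g = m.
  rewrite -lP /z /q !mulr_sumr -big_split/=; apply: eq_bigr => g _.
  by rewrite /t'; ring.
have null_t' : null_rate t' = m.
  rewrite -sum_t'; apply: eq_bigr => g _.
  by rewrite U_id// t'0 t'1.
have : total_rate t' <= value s.
  apply: value_ge; split => //.
  under eq_bigr do rewrite -mulrA.
  rewrite -mulr_sumr sum_t' mulrC -ler_pdivlMr//.
  by rewrite ge_min lexx.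
rewrite /total_rate null_t' => ts.
suff : alt_rate t <= alt_rate t' by lra.
rewrite /alt_rate; under eq_bigr do rewrite -(concdf_clip _ (F_concdf _)).
apply: rate_homo => // g.
by have := min1 g; rewrite /t'; nra.
Qed.

Lemma null_rate_le s t : feasible s t ->
  null_rate t <= Num.min (alpha * s / C) (\sum_g a0 g).
Proof.
move=> [t0 st]; rewrite le_min.
rewrite (rate_le_sum a0_gt0 (fun=> concave_cdf_U))// andbT.
rewrite ler_pdivlMr// mulrC mulr_sumr (le_trans _ st)//.
apply: ler_sum => g _.
rewrite mulrA ler_wpM2l ?mulr_ge0 ?(ltW C_gt0) ?(ltW (a0_gt0 g))//.
by rewrite U_min// ge_min lexx.
Qed.

Lemma feasible_homo s s' t : s <= s' -> feasible s t -> feasible s' t.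
Proof.
move=> ss' [t0 st]; split => //.
by rewrite (le_trans st)// ler_wpM2l// ltW.
Qed.

(* [N0 t] and [N1 t] stand for the proportions of false and true discoveries
   at the thresholds [t], and [bh] for the estimated cost of the weights. *)
Lemma step_up_bounds e : 0 < e -> exists2 dl, 0 < dl &
  forall (N0 N1 : ('I_G -> R) -> R) (bh : 'I_G -> R) (W : R -> 'I_G -> R),
  (forall t, (forall g, 0 <= t g) ->
    0 <= N0 t /\ `|N0 t - null_rate t| <= dl) ->
  (forall t, (forall g, 0 <= t g) ->
    0 <= N1 t /\ `|N1 t - alt_rate t| <= dl) ->
  (forall g, (1 - dl) * (C * a0 g) <= bh g) ->
  (forall g, (1 - dl) * bh g <= C * a0 g) ->
  let N w u := N0 (fun g => alpha * u * w g) + N1 (fun g => alpha * u * w g) in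
  let Kh w := (forall g, 0 <= w g) /\ \sum_g bh g * w g <= 1 in
  (forall u, 0 <= u <= 1 ->
    Kh (W u) /\ forall w, Kh w -> N w u <= N (W u) u) ->
  let uh := crossing (fun u => N (W u) u) in
  net ustar - e <= N1 (fun g => alpha * uh * W uh g) /\
  forall u w, 0 <= u <= uh -> Kh w ->
    N1 (fun g => alpha * u * w g) <= net ustar + e.
Proof.
move=> e0; pose d1 := e / 4; have d1_gt0 : 0 < d1 by rewrite divr_gt0.
(* [h] and [k] are the margins of [value] to the right of [ustar + d1] and at [ustar - d1]. Errors
   below them trap [uh] within [d1] of [ustar]. *)
have [h h0 hP] := value_above_gap d1_gt0.
have [k k0 kP] : exists2 k : R, 0 < k &
    (0 < ustar - d1 -> ustar - d1 + k <= value (ustar - d1)).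
  have [c0|c0] := ltP 0 (ustar - d1); last by exists 1.
  exists (value (ustar - d1) - (ustar - d1)); last by move=> _; lra.
  by rewrite subr_gt0 value_below// gtrBl.
(* Three errors [dl] are set against [h], four against [k], and two, besides the shift [d1], against
   [e]; [1 / 2] keeps [1 - dl] positive. *)
pose dl := Num.min (Num.min (e / 8) (h / 4)) (Num.min (k / 8) (1 / 2)).
have dl_gt0 : 0 < dl by rewrite !lt_min !divr_gt0.
have dle : dl <= e / 8 by rewrite !ge_min lexx.
have dlh : dl <= h / 4 by rewrite !ge_min lexx orbT.
have dlk : dl <= k / 8 by rewrite !ge_min lexx !orbT.
have dl1 : dl <= 1 / 2 by rewrite !ge_min lexx !orbT.
clearbody dl; exists dl => // N0 N1 bh W HN0 HN1 bh_ge bh_le N Kh HW uh.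
have [s0 s1] : 0 <= ustar /\ ustar <= 1 by apply/andP; exact: ustar_itv.
have r01 : 0 <= 1 - dl <= 1 by apply/andP; split; lra.
(* Since rates are at most [1], a factor [1 - dl] costs at most [dl] additively. *)
have loss (x y : R) : x <= 1 -> (1 - dl) * x <= y -> x <= y + dl.
  by move=> x1 xy; nra.
have t_ge0 (u : R) w : 0 <= u -> Kh w -> forall g, 0 <= alpha * u * w g.
  by move=> u0 [w0 _] g; rewrite !mulr_ge0// ltW.
(* Weights of [Kh] respect the estimated cost; the factor [1 - dl] makes their thresholds respect
   the true one. *)
have shrink (u : R) w : 0 <= u -> Kh w ->
    feasible u (fun g => (1 - dl) * (alpha * u * w g)).
  move=> u0 wK; split => [g|].
    by rewrite mulr_ge0 ?t_ge0//; case/andP: r01.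
  have au0 : 0 <= alpha * u by rewrite mulr_ge0// ltW.
  rewrite -[leRHS]mulr1; apply: le_trans (ler_wpM2l au0 wK.2).
  rewrite mulr_sumr; apply: ler_sum => g _.
  have := ler_wpM2l (mulr_ge0 au0 (wK.1 g)) (bh_ge g); lra.
have total_le1 t : (forall g, 0 <= t g) -> null_rate t <= 1 /\ alt_rate t <= 1.
  move=> t0; have := total_rate_le1 t0; rewrite /total_rate.
  have : 0 <= alt_rate t by exact: rate_ge0.
  have : 0 <= null_rate t by exact: (rate_ge0 _ (fun=> concave_cdf_U)).
  by split; lra.
have N_le (u : R) w : 0 <= u -> Kh w -> N w u <= value u + 3 * dl.
  move=> u0 wK; have tge := t_ge0 u w u0 wK.
  have [_ /ler_normlP[_ n0]] := HN0 _ tge.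
  have [_ /ler_normlP[_ n1]] := HN1 _ tge.
  have := loss _ _ (total_rate_le1 tge) (total_rate_scale tge r01).
  have := value_ge (shrink u w u0 wK).
  by rewrite /N /total_rate in n0 n1 *; lra.
have N_ge0 u : 0 <= u <= 1 -> 0 <= N (W u) u.
  move=> u01; have /andP[u0 _] := u01.
  have tge := t_ge0 u _ u0 (HW u u01).1.
  by rewrite addr_ge0 ?(HN0 _ tge).1 ?(HN1 _ tge).1.
have z01 : 0 <= (0 : R) <= 1 by rewrite lexx ler01.
have uh_ub (u : R) : 0 <= u <= 1 -> u <= N (W u) u -> u <= uh.
  by move=> u01 uN; apply: ub_le_sup => //; exists 1 => v /= [/andP[]].
have in0 : [set u : R | 0 <= u <= 1 /\ u <= N (W u) u] 0.
  by split => //; exact: N_ge0.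
have uh0 : 0 <= uh by apply: uh_ub => //; exact: N_ge0.
have uh1 : uh <= 1 by apply: ge_sup; [by exists 0|by move=> v /= [/andP[]]].
have uh01 : 0 <= uh <= 1 by rewrite uh0.
have uh_le : uh <= ustar + d1.
  rewrite leNgt; apply/negP => /sup_gt[]; first by exists 0.
  move=> u /= [u01 uN] su; have /andP[u0 u1] := u01.
  have := N_le u _ u0 (HW u u01).1.
  have : ustar + d1 <= u <= 1 by rewrite ltW.
  by move/hP; lra.
have uh_ge : ustar - d1 <= uh.
  have [c0|c0] := leP (ustar - d1) 0; first exact: le_trans uh0.
  set c := ustar - d1 in c0 kP *.
  have c01 : 0 <= c <= 1 by rewrite ltW//= /c; lra.
  have [t ct tv] : exists2 t, feasible c t & c + k - dl < total_rate t.
    by apply: value_gt; [exact: ltW|have := kP c0; lra].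
  have ac0 : 0 < alpha * c by exact: mulr_gt0.
  (* Near-optimal thresholds turned back into weights. The factor [1 - dl] compensates for an
     estimated cost above the true one, so that [w] competes with [W c]. *)
  pose w g := (1 - dl) * t g / (alpha * c).
  have wK : Kh w.
    split => [g|].
      rewrite divr_ge0 ?(ltW ac0)// mulr_ge0 ?ct.1//.
      by case/andP: r01.
    under eq_bigr do rewrite mulrA; rewrite -mulr_suml ler_pdivrMr// mul1r.
    apply: le_trans ct.2; apply: ler_sum => g _.
    by have := ler_wpM2r (ct.1 g) (bh_le g); lra.
  have Ew : (fun g => alpha * c * w g) = (fun g => (1 - dl) * t g).
    by apply/funext => g; rewrite mulrC divfK// gt_eqF.
  apply: uh_ub => //; apply: le_trans ((HW c c01).2 w wK); rewrite /N Ew.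
  have tge g : 0 <= (1 - dl) * t g.
    by rewrite mulr_ge0 ?ct.1//; case/andP: r01.
  have [_ /ler_normlP[n0 _]] := HN0 _ tge.
  have [_ /ler_normlP[n1 _]] := HN1 _ tge.
  have := loss _ _ (total_rate_le1 ct.1) (total_rate_scale ct.1 r01).
  by rewrite /total_rate in tv n0 n1 *; lra.
(* The supremum is attained: at [uh], the weights [u / uh * W u] still lie in [Kh] and reproduce the
   thresholds of [W u] at [u], so the maximal count is nondecreasing in [u]. *)
have uhN : uh <= N (W uh) uh.
  apply: ge_sup; first by exists 0.
  move=> u /= [u01 uN]; have uuh : u <= uh by exact: uh_ub.
  have [uh_0|uh_neq0] := eqVneq uh 0.
    by apply: (le_trans uuh); rewrite {1}uh_0; exact: N_ge0.
  have uh_gt0 : 0 < uh by rewrite lt_def uh_neq0.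
  apply: (le_trans uN); have [[w0 w1] _] := HW u u01.
  have /andP[u0 u1] := u01.
  have -> : N (W u) u = N (fun g => u / uh * W u g) uh.
    rewrite /N; have -> // : (fun g => alpha * uh * (u / uh * W u g)) =
      (fun g => alpha * u * W u g).
    by apply/funext => g; field.
  apply: (HW uh uh01).2; split => [g|]; first by rewrite mulr_ge0// divr_ge0.
  under eq_bigr do rewrite mulrCA; rewrite -mulr_sumr.
  apply: le_trans (w1); apply: ler_piMl.
    apply: sumr_ge0 => g _; rewrite mulr_ge0//.
    apply: le_trans (bh_ge g); rewrite mulr_ge0 ?mulr_ge0 ?(ltW (a0_gt0 g))//.
      by case/andP: r01.
    exact: ltW.
  by rewrite ler_pdivrMr// mul1r.
split=> [|u w /andP[u0 uuh] wK].
  have WK := (HW uh uh01).1; have tge := t_ge0 uh _ uh0 WK.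
  have [_ /ler_normlP[_ n0]] := HN0 _ tge.
  have := loss _ _ (total_le1 _ tge).1
    (rate_scale a0_gt0 (fun=> concave_cdf_U) tge r01).
  have := null_rate_le (shrink uh _ uh0 WK).
  have := net_homo uh_ge; have : net ustar <= net (ustar - d1) + d1.
    by have := @net_lipschitz (ustar - d1) ustar; rewrite gerBl; lra.
  by move: uhN; rewrite /N /net /null_rate /d1 in n0 *; lra.
have tge := t_ge0 u _ u0 wK.
have [_ /ler_normlP[_ n1]] := HN1 _ tge.
have := loss _ _ (total_le1 _ tge).2 (rate_scale a1_gt0 F_concdf tge r01).
(* The budget is enlarged from [u] to [s] because [value s <= s] holds there, whereas [value u] may
   exceed [u]. *)
set s := Num.min (ustar + d1) 1.
have us : u <= s by rewrite le_min !(le_trans uuh).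
have s_ge0 : 0 <= s by exact: le_trans us.
have := alt_rate_le s_ge0 (feasible_homo us (shrink u w u0 wK)).
have := value_min d1_gt0; rewrite -/s.
have s_le : s <= ustar + d1 by rewrite ge_min lexx.
have := net_homo s_le; have : net (ustar + d1) <= net ustar + d1.
  by have := @net_lipschitz ustar (ustar + d1); rewrite lerDl; lra.
by rewrite /net /alt_rate /d1 in n1 *; lra.
Qed.

End value_function.

(** * From strict concavity on [[0, 1]] to the half-line *)

Section concave_cdf_of_rv.
Context d {T : measurableType d} {R : realType} {P : probability T R}.
Variables (X : {RV P >-> R}) (F : R -> R).
Hypothesis X01 : forall x, 0 <= X x <= 1.
Hypothesis cdfX : forall t, cdf X t = (F t)%:E.
Hypothesis F_concave : strictly_concave01 F.
Hypothesis F0 : F 0 = 0.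

Let F_eq1 t : 1 <= t -> F t = 1.
Proof.
move=> t1; apply/EFin_inj; rewrite -cdfX /cdf /distribution /pushforward/=.
rewrite (_ : _ @^-1` _ = setT) ?probability_setT//.
rewrite -subTset => x _ /=; rewrite in_itv/= (le_trans _ t1)//.
by case/andP: (X01 x).
Qed.

Let F_homo x y : x <= y -> F x <= F y.
Proof. by move=> xy; rewrite -lee_fin -!cdfX; exact: cdf_nondecreasing. Qed.

Let F_clip t : F (Num.min t 1) = F t.
Proof. by case: (leP t 1) => // /ltW t1; rewrite !F_eq1. Qed.

(** Monotonicity, right continuity and the value [1] past [1] come from being the distribution
    function of a [[0, 1]]-valued variable. Capping arguments at [1] does not change [F], which
    carries concavity to the half-line. *)
Lemma concave_cdf_rv : concave_cdf F.
Proof.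
split => //.
- by move=> x y _; exact: F_homo.
- move=> x y t x0 y0 /andP[t0 t1]; rewrite -(F_clip x) -(F_clip y).
  pose x' := Num.min x 1; pose y' := Num.min y 1; rewrite -/x' -/y'.
  have x'01 : 0 <= x' <= 1 by rewrite le_min x0 ler01 ge_min lexx orbT.
  have y'01 : 0 <= y' <= 1 by rewrite le_min y0 ler01 ge_min lexx orbT.
  have x'x : x' <= x by rewrite ge_min lexx.
  have y'y : y' <= y by rewrite ge_min lexx.
  apply: (@le_trans _ _ (F (t * x' + (1 - t) * y'))); last first.
    by apply: F_homo; apply: lerD; apply: ler_wpM2l; rewrite ?subr_ge0.
  have [->|xy] := eqVneq x' y'; first by rewrite -!mulrDl addrC subrK !mul1r.
  have [->|t_neq0] := eqVneq t 0; first by rewrite !mul0r subr0 !mul1r !add0r.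
  have [->|t_neq1] := eqVneq t 1; first by rewrite !mul1r subrr !mul0r !addr0.
  by apply/ltW/F_concave; rewrite // !lt_def t_neq0 t0 eq_sym t_neq1 t1.
- move=> e e0; have := @cdf_right_continuous _ _ _ P X 0.
  have -> : cdf X = EFin \o F by apply/funext => t; exact: cdfX.
  move=> /fine_cvgP[_]; rewrite /= F0 => /cvgrPdist_lt/(_ e e0) Fe.
  have [h [h0 he]] : exists h, 0 < h /\ `|0 - F h| < e.
    near (0 : R)^'+ => h; exists h; split; near: h => //.
    exact: nbhs_right_gt.
  exists h => //; move: he; rewrite sub0r normrN ger0_norm//.
  by rewrite -F0; exact/F_homo/ltW.
Unshelve. all: by end_near. Qed.

(** For [x > 1], where [F x = 1], either [r * x >= 1] and [F (r * x) = 1 > r], or strict concavity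
    on [[0, 1]] gives [r < r * x < F (r * x)]. *)
Lemma strict_concave_rv x r : 0 < x -> 0 < r < 1 -> r * F x < F (r * x).
Proof.
move=> x0 /[dup] r01 /andP[r0 r1].
have scale01 y s : 0 < y <= 1 -> 0 < s < 1 -> s * F y < F (s * y).
  move=> /andP[y0 y1] s01; have y01 : 0 <= y <= 1 by rewrite ltW.
  have z01 : 0 <= (0 : R) <= 1 by rewrite lexx ler01.
  have := F_concave y01 z01 _ s01.
  by rewrite F0 !mulr0 !addr0; apply; rewrite gt_eqF.
have [x1|x1] := leP x 1; first by rewrite scale01 ?x0.
rewrite (F_eq1 (ltW x1)) mulr1; have [rx1|rx1] := leP 1 (r * x).
  by rewrite F_eq1.
have rx01 : 0 < r * x < 1 by rewrite mulr_gt0.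
have := scale01 1 (r * x); rewrite F_eq1// !mulr1 ltr01 lexx => /(_ isT rx01).
by apply: lt_trans; rewrite ltr_pMr.
Qed.

End concave_cdf_of_rv.

(** * Expectations bounded through an exceptional event *)

Section lower_integral.
Local Open Scope ereal_scope.
Context d {T : measurableType d} {R : realType} (P : probability T R).
Implicit Types (f g : T -> R) (B : set T).

(* The integral of a nonnegative function is a supremum over simple functions,
   so that monotonicity does not require measurability. *)
Lemma expectation_le_ge0 f g : (forall x, 0 <= f x <= g x)%R ->
  'E_P[f] <= 'E_P[g].
Proof.
move=> fg; rewrite unlock !ge0_integralTE => [|x|x]; rewrite ?lee_fin.
- apply: ereal_sup_le => _ [h hf <-]; exists h => // x.
  by apply: le_trans (hf x) _; rewrite lee_fin; have /andP[] := fg x.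
- by have /andP[f0 /(le_trans f0)] := fg x.
- by have /andP[] := fg x.
Qed.

Lemma expectation_affine_indic B (a b : R) : measurable B ->
  (0 <= a)%R -> (0 <= b)%R ->
  'E_P[fun x => (a + b * \1_B x)%R] = a%:E + b%:E * P B.
Proof.
move=> mB a0 b0; rewrite unlock.
under eq_integral do rewrite EFinD EFinM.
rewrite ge0_integralD//=; last 2 first.
- by move=> x _; rewrite -EFinM lee_fin mulr_ge0.
- apply/measurable_EFinP; apply: measurable_funM; first exact: measurable_cst.
  exact: measurable_indic.
rewrite integral_cst//= [X in a%:E * X]probability_setT mule1.
rewrite ge0_integralZl_EFin//=; last first.
  by apply/measurable_EFinP; exact: measurable_indic.
by rewrite integral_indic// setIT.
Qed.

Lemma expectation_le_compl f B (a b : R) : measurable B ->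
  (0 <= a)%R -> (0 <= b)%R ->
  (forall x, 0 <= f x <= b)%R -> (forall x, ~ B x -> f x <= a)%R ->
  'E_P[f] <= a%:E + b%:E * P B.
Proof.
move=> mB a0 b0 fb fa.
rewrite -expectation_affine_indic//; apply: expectation_le_ge0 => x.
have /andP[-> fxb] /= := fb x; rewrite indicE.
have [/set_mem Bx|/negP Bx] := boolP (x \in B).
  by rewrite mulr1 (le_trans fxb)// lerDr.
by rewrite mulr0 addr0 fa// => /mem_set.
Qed.

Lemma expectation_ge_compl f B (a : R) : measurable B -> (0 <= a)%R ->
  (forall x, 0 <= f x)%R -> (forall x, ~ B x -> a <= f x)%R ->
  a%:E * (1 - P B) <= 'E_P[f].
Proof.
move=> mB a0 f0 fa; rewrite -probability_setC// -[leLHS]add0e.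
rewrite -expectation_affine_indic//; last exact: measurableC.
apply: expectation_le_ge0 => x; rewrite add0r mulr_ge0//= indicE.
have [/set_mem Bx|_] := boolP (x \in ~` B); last by rewrite mulr0.
by rewrite mulr1 fa.
Qed.

End lower_integral.

(** * Events whose failure probability tends to [0] *)

Section with_high_probability.
Context d {T : measurableType d} {R : realType} (P : probability T R).
Implicit Types E : nat -> T -> Prop.

(** A measurable exceptional set is used instead of the failure set itself, since [E m] may quantify
    over uncountably many thresholds and weights. *)
Definition whp E := forall e : R, 0 < e -> \forall m \near \oo,
  exists B, [/\ measurable B, (P B <= e%:E)%E & forall x, ~ B x -> E m x].

Lemma whp_near E : (\forall m \near \oo, forall x, E m x) -> whp E.
Proof.
move=> nE e e0; near=> m; exists set0; split=> //.
  by rewrite measure0 lee_fin ltW.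
by move=> x _; move: x; near: m.
Unshelve. all: by end_near. Qed.

Lemma whp_and E E' : whp E -> whp E' -> whp (fun m x => E m x /\ E' m x).
Proof.
move=> wE wE' e e0; have e20 : 0 < e / 2 by rewrite divr_gt0.
near=> m.
have [B [mB PB BE]] : exists B,
    [/\ measurable B, (P B <= (e / 2)%:E)%E & forall x, ~ B x -> E m x].
  by near: m; exact: wE.
have [B' [mB' PB' BE']] : exists B,
    [/\ measurable B, (P B <= (e / 2)%:E)%E & forall x, ~ B x -> E' m x].
  by near: m; exact: wE'.
exists (B `|` B'); split; first exact: measurableU.
  rewrite (le_trans (measureU2 _ _ _))// [e]splitr EFinD.
  exact: leeD.
by move=> x /not_orP[Bx B'x]; split; [exact: BE|exact: BE'].
Unshelve. all: by end_near. Qed.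

Lemma whp_sub E E' : whp E -> (forall m x, E m x -> E' m x) -> whp E'.
Proof.
move=> wE EE' e e0; near=> m.
have [B [mB PB BE]] : exists B,
    [/\ measurable B, (P B <= e%:E)%E & forall x, ~ B x -> E m x].
  by near: m; exact: wE.
by exists B; split => // x Bx; apply/EE'/BE.
Unshelve. all: by end_near. Qed.

Lemma whp_forall k (E : 'I_k -> nat -> T -> Prop) :
  (forall i, whp (E i)) -> whp (fun m x => forall i, E i m x).
Proof.
elim: k E => [|k IH] E wE; first by apply: whp_near; near=> m => x [].
apply: whp_sub (whp_and (wE ord0) (IH _ (fun i => wE (lift ord0 i)))) _.
by move=> m x [E0 ES] i; case: (unliftP ord0 i) => [j|] ->.
Unshelve. all: by end_near. Qed.

Lemma cvg_in_probability_whp (X : nat -> T -> R) c :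
  (forall m, measurable_fun setT (X m)) -> cvg_in_probability P X c ->
  forall e, 0 < e -> whp (fun m x => `|X m x - c| < e).
Proof.
move=> mX Xc e e0 a a0.
have /fine_cvgP[_ /cvgrPdist_lt/(_ a a0)] := Xc e e0.
apply: filterS => m; rewrite /= sub0r normrN.
set B := [set x | e <= `|X m x - c|] => PB.
have mB : measurable B.
  rewrite -[B]setTI; apply: measurable_fun_le => //.
  by apply: measurableT_comp => //; exact: measurable_funB.
exists B; split=> // [|x /negP]; last by rewrite -ltNge.
move: PB => /ltW/(le_trans (ler_norm _)).
by rewrite -lee_fin fineK// fin_num_measure.
Qed.

Lemma cvg_of_near_le (u : nat -> \bar R) (l : R) :
  (forall e : R, 0 < e -> \forall m \near \oo,
    ((l - e)%:E <= u m <= (l + e)%:E)%E) ->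
  u @ \oo --> l%:E.
Proof.
move=> ul; have ufin m e : ((l - e)%:E <= u m <= (l + e)%:E)%E ->
    u m \is a fin_num.
  by move=> /andP[lu ul']; rewrite fin_numE; case: (u m) lu ul'.
apply/fine_cvgP; split.
  by near=> m; apply: (ufin m 1); near: m; exact: ul.
apply/cvgrPdist_le => e e0; near=> m.
have ume : ((l - e)%:E <= u m <= (l + e)%:E)%E by near: m; exact: ul.
have := ume; rewrite /= -(fineK (ufin m e ume)) !lee_fin => /andP[? ?].
by rewrite ler_norml; apply/andP; split; lra.
Unshelve. all: by end_near. Qed.

Lemma limn_esup_le_near (u : nat -> \bar R) (l : R) :
  (forall e : R, 0 < e -> \forall m \near \oo, (u m <= (l + e)%:E)%E) ->
  (limn_esup u <= l%:E)%E.
Proof.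
move=> ul; apply/lee_addgt0Pr => e e0; have [N _ uN] := ul e e0.
apply: (@le_trans _ _ (ereal_sup (u @` [set m | (N <= m)%N]))).
  apply: ereal_inf_lbound; exists [set m | (N <= m)%N] => //.
  by exists N.
by apply: ge_ereal_sup => _ [m Nm <-]; rewrite -EFinD; exact: uN.
Qed.

End with_high_probability.

(** * Empirical distribution functions and discovery counts *)

Section sub_ecdf.
Context {R : realType} {k : nat}.
Implicit Types (Q b : 'I_k -> bool) (q : 'I_k -> R) (t : R).

Definition sub_ecdf Q q t : R :=
  (\sum_(i < k) Q i)%N%:R^-1 * \sum_(i < k) ((q i <= t) && Q i)%:R.

Lemma sub_count_le Q b :
  \sum_(i < k) (b i && Q i)%:R <= (\sum_(i < k) Q i)%N%:R :> R.
Proof. by rewrite natr_sum; apply: ler_sum => i _; case: b; case: Q. Qed.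

(** For empty [Q] the left side is [0], and the count on the right, bounded by the size of [Q],
    vanishes too. *)
Lemma mul_sub_ecdf Q q t :
  (\sum_(i < k) Q i)%N%:R * sub_ecdf Q q t =
  \sum_(i < k) ((q i <= t) && Q i)%:R.
Proof.
have [Q0|Q0] := eqVneq ((\sum_(i < k) Q i)%N%:R : R) 0; last first.
  by rewrite mulrA divff// mul1r.
have := sub_count_le Q (fun i => q i <= t); rewrite Q0 mul0r => s0.
by apply/esym/eqP; rewrite eq_le s0 sumr_ge0.
Qed.

Lemma sub_ecdf_ge0 Q q t : 0 <= sub_ecdf Q q t.
Proof. by rewrite mulr_ge0 ?invr_ge0// sumr_ge0. Qed.

Lemma sub_ecdf_le1 Q q t : sub_ecdf Q q t <= 1.
Proof.
rewrite /sub_ecdf mulrC; have [->|Q0] := eqVneq ((\sum_(i < k) Q i)%N%:R : R) 0.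
  by rewrite invr0 mulr0.
have Q_gt0 : 0 < (\sum_(i < k) Q i)%N%:R :> R by rewrite lt_def Q0/=.
by rewrite ler_pdivrMr// mul1r; exact: (sub_count_le Q (fun i => q i <= t)).
Qed.

Lemma sub_ecdf_homo Q q : {homo sub_ecdf Q q : s t / s <= t}.
Proof.
move=> s t st; rewrite ler_wpM2l ?invr_ge0//; apply: ler_sum => i _.
case: (Q i); rewrite ?andbF// !andbT ler_nat.
by case: (leP (q i) s) => // /le_trans/(_ st) ->.
Qed.

End sub_ecdf.

Lemma measurable_sub_ecdf d (T : measurableType d) (R : realType) k
    (Q : 'I_k -> bool) (q : 'I_k -> T -> R) t :
  (forall i, measurable_fun setT (q i)) ->
  measurable_fun setT (fun x => sub_ecdf Q (fun i => q i x) t).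
Proof.
move=> mq; apply: measurable_funM; first exact: measurable_cst.
apply: measurable_sum => i; case: (Q i).
  under eq_fun do rewrite andbT.
  have -> : (fun x => (q i x <= t)%R%:R) = \1_(q i @^-1` `]-oo, t]) :> (T -> R).
    apply/funext => x; rewrite indicE; congr ((nat_of_bool _)%:R).
    apply/idP/idP => [xt|/set_mem]; last by rewrite /= in_itv.
    by apply/mem_set; rewrite /= in_itv.
  apply: measurable_indic; rewrite -[_ @^-1` _]setTI.
  exact: (mq i measurableT).
by under eq_fun do rewrite andbF; exact: measurable_cst.
Qed.

Section counts.
Context {R : realType} {G : nat} {n : 'I_G -> nat}.
Context (H : forall g, 'I_(n g) -> bool) (p : forall g, 'I_(n g) -> R).
Arguments H : clear implicits.
Arguments p : clear implicits.
Implicit Types (t w : 'I_G -> R) (g : 'I_G) (alpha u : R) (W : R -> 'I_G -> R).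

Lemma nb_nullE g : nb_null H g = (\sum_(i < n g) ~~ H g i)%N.
Proof.
rewrite /nb_null /nb_alt -[X in (X - _)%N]card_ord -sum1_card.
rewrite (eq_bigr (fun i => H g i + ~~ H g i)%N) => [|i _].
  by rewrite big_split/= addKn.
by case: (H g i).
Qed.

Lemma nb_null_alt g : (nb_null H g + nb_alt H g)%N = n g.
Proof.
rewrite nb_nullE /nb_alt -big_split/= -[RHS]card_ord -sum1_card.
by apply: eq_bigr => i _; case: (H g i).
Qed.

Lemma null_ecdfE g (t : R) :
  null_ecdf H p g t = sub_ecdf (fun i => ~~ H g i) (p g) t.
Proof. by rewrite /null_ecdf nb_nullE. Qed.

Lemma alt_ecdfE g (t : R) : alt_ecdf H p g t = sub_ecdf (H g) (p g) t.
Proof. by []. Qed.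

(** Empirical counterpart of [null_rate], for an arbitrary threshold vector: the random weights are
    substituted only after a bound uniform in [t] is known. *)
Definition null_disc t : R := (ntests n)%:R^-1 *
  \sum_g \sum_(i < n g) ((p g i <= t g) && ~~ H g i)%:R.

Definition alt_disc t : R := (ntests n)%:R^-1 *
  \sum_g \sum_(i < n g) ((p g i <= t g) && H g i)%:R.

Lemma null_discE t : null_disc t =
  \sum_g (nb_null H g)%:R / (ntests n)%:R * null_ecdf H p g (t g).
Proof.
rewrite /null_disc mulr_sumr; apply: eq_bigr => g _.
by rewrite mulrAC null_ecdfE nb_nullE mul_sub_ecdf mulrC.
Qed.

Lemma alt_discE t : alt_disc t =
  \sum_g (nb_alt H g)%:R / (ntests n)%:R * alt_ecdf H p g (t g).
Proof.
rewrite /alt_disc mulr_sumr; apply: eq_bigr => g _.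
by rewrite mulrAC alt_ecdfE mul_sub_ecdf mulrC.
Qed.

Lemma null_disc_ge0 t : 0 <= null_disc t.
Proof. by rewrite mulr_ge0 ?invr_ge0// sumr_ge0// => g _; rewrite sumr_ge0. Qed.

Lemma alt_disc_ge0 t : 0 <= alt_disc t.
Proof. by rewrite mulr_ge0 ?invr_ge0// sumr_ge0// => g _; rewrite sumr_ge0. Qed.

Lemma alt_disc_homo t t' : (forall g, t g <= t' g) -> alt_disc t <= alt_disc t'.
Proof.
move=> tt'; rewrite !alt_discE; apply: ler_sum => g _.
by rewrite ler_wpM2l ?divr_ge0// !alt_ecdfE; exact: sub_ecdf_homo.
Qed.

Lemma GhatE alpha W u : Ghat alpha p W u =
  null_disc (fun g => alpha * u * W u g) +
  alt_disc (fun g => alpha * u * W u g).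
Proof.
rewrite /Ghat /null_disc /alt_disc -mulrDr -big_split/=; congr (_ * _).
apply: eq_bigr => g _; rewrite -big_split/=; apply: eq_bigr => i _.
by case: (H g i); rewrite ?andbT ?andbF ?add0r ?addr0.
Qed.

Lemma Ghat_ge0 alpha W u : 0 <= Ghat alpha p W u.
Proof. by rewrite GhatE addr_ge0 ?null_disc_ge0 ?alt_disc_ge0. Qed.

Lemma card_true_rejections alpha W u :
  (ntests n)%:R^-1 *
    #|rejections alpha p W u :&: alternatives H|%SET%:R =
  alt_disc (fun g => alpha * u * W u g).
Proof.
congr (_ * _); under [RHS]eq_bigr do rewrite -natr_sum.
rewrite -natr_sum; congr (_%:R); rewrite -sum1_card.
rewrite big_mkcond/= sig_big_dep/=; apply: eq_bigr => k _.
by rewrite !inE; case: ifP.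
Qed.

Lemma card_true_rejections_le (A : {set hypothesis n}) :
  (#|A :&: alternatives H| <= ntests n)%N.
Proof.
apply: leq_trans (max_card _) _; rewrite card_tagged sumnE big_map big_enum/=.
by under eq_bigr do rewrite card_ord.
Qed.

End counts.

(** * Stopping points and admissibility of the explicit weights *)

Section step_up.
Context {R : realType} {G : nat} {n : 'I_G -> nat}.
Context (alpha : R) (p : forall g, 'I_(n g) -> R) (ph : 'I_G -> R).
Hypothesis ph01 : forall g, 0 < ph g <= 1.
Implicit Types (w : 'I_G -> R) (u : R) (W : R -> 'I_G -> R).

Let set0_uhat W : [set u : R | 0 <= u <= 1 /\ u <= Ghat alpha p W u] 0.
Proof.
(* [Ghat] ignores which nulls are true; the constant [true] merely instantiates the split into null
   and alternative counts. *)
by split; rewrite ?lexx ?ler01// (Ghat_ge0 (fun _ _ => true)).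
Qed.

Lemma uhat_itv W : 0 <= uhat alpha p W <= 1.
Proof.
apply/andP; split; last first.
  by apply: ge_sup; [by exists 0|by move=> v /= [/andP[]]].
by apply: ub_le_sup => //; exists 1 => v /= [/andP[]].
Qed.

(** [Ghat] is pointwise largest for [W], so the set whose supremum defines [uhat] can only grow. *)
Lemma uhat_le_optimal W w : optimal_weights alpha p ph W -> Khat n ph w ->
  uhat alpha p (fun=> w) <= uhat alpha p W.
Proof.
move=> oW wK; apply: ge_sup; first by exists 0.
move=> u /= [u01 uG]; apply: ub_le_sup; first by exists 1 => v /= [/andP[]].
by split => //; apply: le_trans uG _; exact: (oW u u01).2.
Qed.

Let mean_ge0 : 0 <= pihat0_mean n ph.
Proof.
apply: sumr_ge0 => g _; rewrite mulr_ge0 ?divr_ge0//.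
by have /andP[/ltW] := ph01 g.
Qed.

Lemma Khat_what1 : Khat n ph (what1 n ph).
Proof.
split => [g|]; first by rewrite invr_ge0.
rewrite -mulr_suml -/(pihat0_mean n ph).
(* A zero mean makes the weights [0], because [0^-1 = 0]. *)
have [->|m0] := eqVneq (pihat0_mean n ph) 0; first by rewrite mul0r.
by rewrite divff.
Qed.

(** The factors [ph g] cancel and the cost sums to [(1 - mean) / (1 - mean)]: the budget is exactly
    exhausted. Positivity of [ntests n] makes the group proportions add up to [1]. *)
Lemma Khat_what2 : (0 < ntests n)%N -> pihat0_mean n ph < 1 ->
  Khat n ph (what2 n ph).
Proof.
move=> n0 m1; have m1' : 0 < 1 - pihat0_mean n ph by rewrite subr_gt0.
split => [g|].
  have /andP[ph0 ph1] := ph01 g.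
  by rewrite divr_ge0 ?subr_ge0// mulr_ge0 ?ltW.
rewrite (eq_bigr (fun g => ((n g)%:R / (ntests n)%:R -
    (n g)%:R / (ntests n)%:R * ph g) / (1 - pihat0_mean n ph))); last first.
  move=> g _; have /andP[ph0 _] := ph01 g; rewrite /what2; field.
  by rewrite !gt_eqF// ltr0n.
rewrite -mulr_suml sumrB -/(pihat0_mean n ph) -mulr_suml -natr_sum divff.
  by rewrite divff// gt_eqF.
by rewrite pnatr_eq0 -lt0n.
Qed.

End step_up.

Section power.
Local Open Scope ereal_scope.
Context d {T : measurableType d} {R : realType} (P : probability T R).
Context {G : nat} {n : 'I_G -> nat} (H : forall g, 'I_(n g) -> bool).
Variables (A : T -> {set hypothesis n}) (B : set T) (a : R).
Hypotheses (n_gt0 : (0 < ntests n)%N) (mB : measurable B) (a0 : (0 <= a)%R).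

Let card x : R := #|A x :&: alternatives H|%SET%:R.

Let m_gt0 : (0 < (ntests n)%:R :> R)%R. Proof. by rewrite ltr0n. Qed.

Lemma Pow_ge0 : 0 <= Pow P H A.
Proof. by rewrite mule_ge0 ?lee_fin ?invr_ge0// expectation_ge0. Qed.

Lemma Pow_le : (forall x, ~ B x -> (ntests n)%:R^-1 * card x <= a)%R ->
  Pow P H A <= a%:E + P B.
Proof.
move=> Aa; rewrite /Pow muleC lee_pdivrMr// muleDl//.
rewrite -EFinM (muleC (P B)); apply: expectation_le_compl => //.
- by rewrite mulr_ge0// ltW.
- by move=> x; rewrite ler_nat card_true_rejections_le ler0n.
- by move=> x /Aa; rewrite mulrC ler_pdivrMr.
Qed.

Lemma Pow_ge : (forall x, ~ B x -> a <= (ntests n)%:R^-1 * card x)%R ->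
  a%:E * (1 - P B) <= Pow P H A.
Proof.
move=> Aa; rewrite /Pow [leRHS]muleC lee_pdivlMr// muleAC -EFinM.
apply: expectation_ge_compl => //.
- by rewrite mulr_ge0// ltW.
- by move=> x /Aa; rewrite mulrC ler_pdivlMr.
Qed.

End power.

(** Glivenko-Cantelli in probability: [polya] reduces uniform closeness to finitely many nodes,
    whose exceptional sets have a union of small probability. *)
Lemma whp_uniform d (T : measurableType d) (R : realType)
    (P : probability T R) (phi : R -> R) (psi : nat -> T -> R -> R) (e : R) :
  concave_cdf phi -> 0 < e ->
  (forall m x, {homo psi m x : s t / s <= t}) ->
  (forall m x t, psi m x t <= 1) ->
  (forall m t, measurable_fun setT (fun x => psi m x t)) ->
  (forall t, 0 <= t -> cvg_in_probability P (fun m x => psi m x t) (phi t)) ->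
  whp P (fun m x => forall t, 0 <= t -> `|psi m x t - phi t| <= e).
Proof.
move=> cphi e0 psi_homo psi_le1 mpsi psi_cvg.
have e20 : 0 < e / 2 by rewrite divr_gt0.
have [k kP] := polya cphi e20.
have wk : whp P (fun m x => forall j : 'I_k.+1,
    `|psi m x (j%:R / k%:R) - phi (j%:R / k%:R)| < e / 2).
  apply: whp_forall => j; apply: cvg_in_probability_whp => //.
  by apply: psi_cvg; rewrite divr_ge0.
apply: whp_sub wk _ => m x grid t t0.
have := kP (psi m x) (psi_homo m x) (psi_le1 m x) grid t t0.
by rewrite mulrC divfK.
Qed.

Lemma weighted_sum_dist (R : realType) G (c c' x y : 'I_G -> R) (dl : R) :
  (forall g, 0 <= c g <= 1) -> (forall g, 0 <= x g <= 1) ->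
  (forall g, `|c' g - c g| <= dl) -> (forall g, `|x g - y g| <= dl) ->
  `|\sum_g c' g * x g - \sum_g c g * y g| <= G%:R * (2 * dl).
Proof.
move=> c01 x01 cc' xy; rewrite -sumrB.
apply: le_trans (ler_norm_sum _ _ _) _.
rewrite mulr_natl -[X in _ *+ X]card_ord -sumr_const; apply: ler_sum => g _.
have -> : c' g * x g - c g * y g = (c' g - c g) * x g + c g * (x g - y g).
  by ring.
apply: le_trans (ler_normD _ _) _; rewrite !normrM mulr_natl mulr2n.
have /andP[c0 c1] := c01 g; have /andP[x0 x1] := x01 g.
rewrite (ger0_norm c0) (ger0_norm x0); apply: lerD.
  by apply: le_trans (cc' g); rewrite ler_piMr.
by apply: le_trans (xy g); rewrite ler_piMl.
Qed.

(** * Concentration of the estimates and the limiting power *)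

Section asymptotics.
Context {R : realType} d {T : measurableType d} {P : probability T R}.
Context {G : nat} (n : nat -> 'I_G -> nat).
Context (H : forall m g, 'I_(n m g) -> bool).
Context (p : forall m g, 'I_(n m g) -> {RV P >-> R}).
Arguments H : clear implicits.
Arguments p : clear implicits.
Variables (F : 'I_G -> R -> R) (pi pi0 pibar0 : 'I_G -> R).
Variables (pihat0 : nat -> 'I_G -> {RV P >-> R}) (C alpha : R).
Variable What : nat -> T -> R -> 'I_G -> R.
Hypothesis n_sum : forall m, (\sum_g n m g)%N = m.
Hypothesis p01 : forall m g (i : 'I_(n m g)) x, 0 <= p m g i x <= 1.
Hypothesis p_alt : forall m g (i : 'I_(n m g)), H m g i = true ->
  forall t, cdf (p m g i) t = (F g t)%:E.
Hypothesis F_concave : forall g, strictly_concave01 (F g).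
Hypothesis F0 : forall g, F g 0 = 0.
Hypothesis pi_gt0 : forall g, 0 < pi g.
Hypothesis pi0_gt0 : forall g, 0 < pi0 g.
Hypothesis pi1_gt0 : forall g, 0 < 1 - pi0 g.
Hypothesis pi_cvg : forall g, (n m g)%:R / m%:R @[m --> \oo] --> pi g.
Hypothesis pi0_cvg : forall g,
  (nb_null (H m) g)%:R / (n m g)%:R @[m --> \oo] --> pi0 g.
Hypothesis weak_dep_null : forall g (t : R), 0 <= t -> cvg_in_probability P
  (fun m x => null_ecdf (H m) (fun g i => p m g i x) g t) (U t).
Hypothesis weak_dep_alt : forall g (t : R), 0 <= t -> cvg_in_probability P
  (fun m x => alt_ecdf (H m) (fun g i => p m g i x) g t) (F g t).
Hypothesis pihat0_01 : forall m g x, 0 < pihat0 m g x <= 1.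
Hypothesis pihat0_cvg : forall g,
  cvg_in_probability P (fun m x => pihat0 m g x) (pibar0 g).
Hypothesis alpha_lt1 : alpha < 1.
Hypothesis What_opt : forall m x,
  optimal_weights alpha (fun g i => p m g i x) (fun g => pihat0 m g x)
    (What m x).
Hypothesis C_ge1 : 1 <= C.
Hypothesis pibar0E : forall g, pibar0 g = C * pi0 g.

Let a0 g := pi g * pi0 g.
Let a1 g := pi g * (1 - pi0 g).

Let ntestsE m : ntests (n m) = m. Proof. exact: n_sum. Qed.

Let null_cvg g : (nb_null (H m) g)%:R / m%:R @[m --> \oo] --> a0 g.
Proof.
rewrite /a0 mulrC.
have -> : (fun m => (nb_null (H m) g)%:R / m%:R : R) =
    (fun m => (nb_null (H m) g)%:R / (n m g)%:R * ((n m g)%:R / m%:R)).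
  apply/funext => m; have [n0|n_neq0] := eqVneq (n m g) 0%N.
    by rewrite /nb_null n0 sub0n !mul0r.
  by rewrite mulrA divfK// pnatr_eq0.
by apply: cvgM; [exact: pi0_cvg|exact: pi_cvg].
Qed.

Let alt_cvg g : (nb_alt (H m) g)%:R / m%:R @[m --> \oo] --> a1 g.
Proof.
rewrite /a1 mulrBr mulr1 -/(a0 g).
have -> : (fun m => (nb_alt (H m) g)%:R / m%:R : R) =
    (fun m => (n m g)%:R / m%:R - (nb_null (H m) g)%:R / m%:R).
  by apply/funext => m; rewrite -(nb_null_alt (H m) g) natrD mulrDl addrC addKr.
by apply: cvgB; [exact: pi_cvg|exact: null_cvg].
Qed.

Let pi_sum : \sum_g pi g = 1.
Proof.
have : (fun m => \sum_g (n m g)%:R / m%:R : R) @ \oo --> \sum_g pi g.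
  by apply: cvg_big => [|g _]; [exact: add_continuous|exact: pi_cvg].
have : (fun m => \sum_g (n m g)%:R / m%:R : R) @ \oo --> (1 : R).
  apply: cvg_near_cst; near=> m.
  rewrite -mulr_suml -natr_sum n_sum divff// pnatr_eq0 -lt0n.
  by near: m; exact: nbhs_infty_gt.
by move=> c1 cpi; exact: (cvg_unique _ cpi c1).
Unshelve. all: by end_near. Qed.

Let a01 : \sum_g a0 g + \sum_g a1 g = 1.
Proof.
rewrite -big_split -pi_sum; apply: eq_bigr => g _ /=.
by rewrite /a0 /a1; ring.
Qed.

(** [F g] is known to be a distribution function only through some false null of group [g]. One
    exists because the null proportion tends to [pi0 g < 1]; positivity of that proportion excludes
    an empty group, where [0 / 0 = 0] would also be below [1]. *)
Let ex_alt g : exists m (i : 'I_(n m g)), H m g i.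
Proof.
have := @pi0_cvg g; have pi0_lt1 : pi0 g < 1 by rewrite -subr_gt0.
move=> /cvgr_lt/(_ _ pi0_lt1) lt1; have := @pi0_cvg g.
move=> /cvgr_gt/(_ _ (pi0_gt0 g)) gt0.
have [m [m_gt0 m_lt1]] : exists m,
    0 < (nb_null (H m) g)%:R / (n m g)%:R :> R /\
    (nb_null (H m) g)%:R / (n m g)%:R < 1 :> R.
  by near \oo => m; exists m; split; near: m.
have n_gt0 : 0 < (n m g)%:R :> R.
  rewrite ltr0n lt0n; apply/eqP => n0; move: m_gt0.
  by rewrite n0 invr0 mulr0 ltxx.
exists m; apply: contrapT => noalt; move: m_lt1; rewrite ltr_pdivrMr// mul1r.
rewrite -(nb_null_alt (H m) g) /nb_alt big1 ?addn0 ?ltxx// => i _.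
by apply/eqP; rewrite eqb0; apply/negP => Hi; apply: noalt; exists i.
Unshelve. all: by end_near. Qed.

Let F_concdf g : concave_cdf (F g).
Proof.
have [m [i Hi]] := ex_alt g.
exact: (concave_cdf_rv (@p01 m g i) (p_alt Hi)).
Qed.

Let F_strict g (x r : R) : 0 < x -> 0 < r < 1 -> r * F g x < F g (r * x).
Proof.
have [m [i Hi]] := ex_alt g.
exact: (strict_concave_rv (@p01 m g i) (p_alt Hi)).
Qed.

Let a0_gt0 g : 0 < a0 g. Proof. exact: mulr_gt0. Qed.
Let a1_gt0 g : 0 < a1 g. Proof. exact: mulr_gt0. Qed.

Let pv m x : forall g, 'I_(n m g) -> R := fun g i => p m g i x.
Let ph m x : 'I_G -> R := fun g => pihat0 m g x.

Lemma whp_ecdf (e : R) : 0 < e -> whp P (fun m x => forall g t, 0 <= t ->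
  `|null_ecdf (H m) (@pv m x) g t - U t| <= e /\
  `|alt_ecdf (H m) (@pv m x) g t - F g t| <= e).
Proof.
move=> e0; apply: whp_forall => g.
have w0 : whp P (fun m x => forall t, 0 <= t ->
    `|null_ecdf (H m) (@pv m x) g t - U t| <= e).
  apply: whp_uniform => //.
  - exact: concave_cdf_U.
  - by move=> m x s t st; rewrite !null_ecdfE; exact: sub_ecdf_homo.
  - by move=> m x t; rewrite null_ecdfE; exact: sub_ecdf_le1.
  - move=> m t; under eq_fun do rewrite null_ecdfE.
    exact: (@measurable_sub_ecdf _ _ _ _ _ (fun i x => p m g i x)).
  - by move=> t; exact: weak_dep_null.
have w1 : whp P (fun m x => forall t, 0 <= t ->
    `|alt_ecdf (H m) (@pv m x) g t - F g t| <= e).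
  apply: whp_uniform => //.
  - by move=> m x s t st; exact: sub_ecdf_homo.
  - by move=> m x t; exact: sub_ecdf_le1.
  - move=> m t.
    exact: (@measurable_sub_ecdf _ _ _ _ _ (fun i x => p m g i x)).
  - by move=> t; exact: weak_dep_alt.
apply: whp_sub (whp_and w0 w1) _ => m x [h0 h1] t t0.
by split; [exact: h0|exact: h1].
Qed.

Let disc_near (m : nat) x (dl : R) :
  (forall g t, 0 <= t ->
    `|null_ecdf (H m) (@pv m x) g t - U t| <= dl /\
    `|alt_ecdf (H m) (@pv m x) g t - F g t| <= dl) ->
  (forall g, `|(nb_null (H m) g)%:R / m%:R - a0 g| <= dl) ->
  (forall g, `|(nb_alt (H m) g)%:R / m%:R - a1 g| <= dl) ->
  forall t, (forall g, 0 <= t g) ->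
  `|null_disc (H m) (@pv m x) t - null_rate a0 t| <= G%:R * (2 * dl) /\
  `|alt_disc (H m) (@pv m x) t - alt_rate F a1 t| <= G%:R * (2 * dl).
Proof.
move=> ecdf_near null_near alt_near t t0.
have pi_le1 g : pi g <= 1.
  by rewrite -pi_sum (bigD1 g)//= lerDl sumr_ge0// => k _; exact: ltW.
have a_le1 g (c : R) : 0 < c -> 0 < 1 - c -> 0 <= pi g * c <= 1.
  move=> c0 c1; apply/andP; split; first exact/ltW/mulr_gt0.
  apply: mulr_ile1; [exact: ltW|exact: ltW|exact: pi_le1|].
  by rewrite -subr_ge0 ltW.
rewrite null_discE alt_discE ntestsE; split; apply: weighted_sum_dist => // g.
- exact: a_le1.
- by rewrite null_ecdfE sub_ecdf_ge0 sub_ecdf_le1.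
- exact: (ecdf_near g _ (t0 g)).1.
- by apply: a_le1; rewrite ?subKr.
- by rewrite alt_ecdfE sub_ecdf_ge0 sub_ecdf_le1.
- exact: (ecdf_near g _ (t0 g)).2.
Qed.

Lemma whp_estimates (e : R) : 0 < e -> whp P (fun m x => [/\ (0 < m)%N,
  (forall t, (forall g, 0 <= t g) ->
    `|null_disc (H m) (@pv m x) t - null_rate a0 t| <= e /\
    `|alt_disc (H m) (@pv m x) t - alt_rate F a1 t| <= e),
  (forall g, (1 - e) * (C * a0 g) <= (n m g)%:R / m%:R * ph m x g) &
  (forall g, (1 - e) * ((n m g)%:R / m%:R * ph m x g) <= C * a0 g)]).
Proof.
move=> e0; have C_gt0 : 0 < C by exact: lt_le_trans C_ge1.
have [b b0 bP] : exists2 b : R, 0 < b & forall g, b <= C * a0 g.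
  by apply: finite_lower_bound => g; exact: mulr_gt0.
have G1_gt0 : 0 < G.+1%:R :> R by rewrite ltr0n.
(* The first bound absorbs an error [2 * dl] per group. The second makes the additive error on the
   costs relative, as every true cost is at least [b]. *)
pose dl := Num.min (e / (2 * G.+1%:R)) (e * b / 4).
have dl0 : 0 < dl by rewrite lt_min !divr_gt0 ?mulr_gt0.
have dlG : G%:R * (2 * dl) <= e.
  apply: (@le_trans _ _ (G.+1%:R * (2 * dl))).
    by rewrite ler_wpM2r ?ler_nat// mulr_ge0// ltW.
  have -> : G.+1%:R * (2 * dl) = dl * (2 * G.+1%:R) by ring.
  by rewrite -ler_pdivlMr ?mulr_gt0// ge_min lexx.
have dlb : dl <= e * b / 4 by rewrite ge_min lexx orbT.
have w1 : whp P (fun m x => forall g, `|ph m x g - pibar0 g| < dl).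
  apply: whp_forall => g; apply: cvg_in_probability_whp => //.
  exact: pihat0_cvg.
have w2 : whp P (fun m _ => (0 < m)%N /\ forall g,
    [/\ `|(nb_null (H m) g)%:R / m%:R - a0 g| <= dl,
        `|(nb_alt (H m) g)%:R / m%:R - a1 g| <= dl &
        `|(n m g)%:R / m%:R - pi g| <= dl]).
  apply: whp_and.
    by apply: whp_near; near do move=> _; exact: nbhs_infty_gt.
  apply: whp_forall => g; apply: whp_near; near=> m => _; split.
  - rewrite distrC; near: m; exact: (cvgrPdist_le _ _).1 (@null_cvg g) _ dl0.
  - rewrite distrC; near: m; exact: (cvgrPdist_le _ _).1 (@alt_cvg g) _ dl0.
  - rewrite distrC; near: m; exact: (cvgrPdist_le _ _).1 (@pi_cvg g) _ dl0.
apply: whp_sub (whp_and (whp_ecdf dl0) (whp_and w1 w2)) _.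
move=> m x [ecdf_near [ph_near [m0 near_m]]].
have near_m0 g := let: And3 h _ _ := near_m g in h.
have near_m1 g := let: And3 _ h _ := near_m g in h.
have near_mn g := let: And3 _ _ h := near_m g in h.
have bh_near g :
    `|(n m g)%:R / m%:R * ph m x g - C * a0 g| <= e * (C * a0 g) / 2.
  have -> : C * a0 g = pi g * pibar0 g by rewrite pibar0E /a0; ring.
  apply: (@le_trans _ _ (2 * dl)); last first.
    have := bP g; rewrite /a0 => bg.
    have : e * b <= e * (C * (pi g * pi0 g)) by rewrite ler_pM2l.
    rewrite pibar0E; move: dlb; lra.
  have -> : (n m g)%:R / m%:R * ph m x g - pi g * pibar0 g =
    ((n m g)%:R / m%:R - pi g) * ph m x g + pi g * (ph m x g - pibar0 g).
    by ring.
  apply: le_trans (ler_normD _ _) _; rewrite !normrM.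
  have -> : 2 * dl = dl + dl by ring.
  have /andP[ph0 ph1] := pihat0_01 m g x.
  have pi_le1 : pi g <= 1.
    by rewrite -pi_sum (bigD1 g)//= lerDl sumr_ge0// => k _; exact: ltW.
  apply: lerD.
    by apply: le_trans (near_mn g); rewrite ler_piMr// gtr0_norm.
  apply: le_trans (ltW (ph_near g)).
  by rewrite ler_piMl// gtr0_norm.
split=> [//|t t0|g|g].
- have [h0 h1] := disc_near ecdf_near near_m0 near_m1 t0.
  by split; [exact: le_trans h0 _|exact: le_trans h1 _].
- have := bh_near g; have : 0 < C * a0 g by exact: mulr_gt0.
  by move=> Ca0 /ler_normlP[]; have := mulr_gt0 e0 Ca0; lra.
- have := bh_near g; have Ca0 : 0 < C * a0 g by exact: mulr_gt0.
  have bh0 : 0 <= (n m g)%:R / m%:R * ph m x g.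
    by rewrite mulr_ge0 ?divr_ge0//; have /andP[/ltW] := pihat0_01 m g x.
  move=> /ler_normlP[_].
  set y := _ * ph m x g in bh0 *; set z := C * a0 g in Ca0 *.
  (* For [e >= 1] the left side is nonpositive; otherwise [(1 - e) * (1 + e / 2) <= 1]. *)
  have [e1|e1] := leP 1 e; first by nra.
  move=> yz; have : (1 - e) * y <= (1 - e) * (z + e * z / 2).
    by rewrite ler_wpM2l; lra.
  have : 0 <= e * e * z by rewrite !mulr_ge0// ltW.
  have : 0 <= e * z by rewrite !mulr_ge0// ltW.
  nra.
Unshelve. all: by end_near. Qed.

(** The upper bound ranges over all [u <= uh] and all weights of [Khat], so it covers ADDOW itself
    and every competitor at once. *)
Lemma addow_limit : exists2 l : R, 0 <= l <= 1 &
  forall e : R, 0 < e -> whp P (fun m x =>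
    let uh := uhat alpha (@pv m x) (What m x) in
    [/\ (0 < m)%N,
      l - e <= alt_disc (H m) (@pv m x) (fun g => alpha * uh * What m x uh g) &
      forall u w, 0 <= u <= uh -> Khat (n m) (ph m x) w ->
        alt_disc (H m) (@pv m x) (fun g => alpha * u * w g) <= l + e]).
Proof.
(* If [alpha <= 0], all thresholds are nonpositive and [F g 0 = 0] forces the limit [0]. *)
have [alpha_gt0|alpha_le0] := ltP 0 alpha; last first.
  exists 0; rewrite ?lexx ?ler01// => e e0.
  apply: whp_sub (whp_estimates e0) _ => m x [m0 disc_e _ _] uh; split=> //.
    apply: (@le_trans _ _ 0); last exact: alt_disc_ge0.
    by rewrite sub0r oppr_le0 ltW.
  move=> u w /andP[u0 _] [w0 _].
  apply: (@le_trans _ _ (alt_disc (H m) (@pv m x) (fun=> 0))).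
    apply: alt_disc_homo => g; rewrite -mulrA mulr_le0_ge0// mulr_ge0//.
  have [_ /ler_normlP[_]] := disc_e (fun=> 0) (fun=> lexx 0).
  rewrite /alt_rate big1 ?subr0 ?add0r// => g _.
  by rewrite F0 mulr0.
pose v := value F a0 a1 C alpha; pose nt := net a0 C alpha (crossing v).
have C_gt0 : 0 < C by exact: lt_le_trans C_ge1.
have us01 : 0 <= crossing v <= 1.
  exact: ustar_itv.
have /andP[us0 us1] := us01.
have sum_a0 : 0 <= \sum_g a0 g by apply: sumr_ge0 => g _; exact: ltW.
exists nt.
  apply/andP; split.
    apply: (@le_trans _ _ (net a0 C alpha 0)); last exact: net_homo.
    by rewrite /net mulr0 mul0r min_l// subr0.
  apply: le_trans us1; rewrite /nt /net gerBl le_min sum_a0 andbT.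
  by rewrite divr_ge0 ?(ltW C_gt0)// mulr_ge0// ltW.
move=> e e0.
have [dl dl0 step] := step_up_bounds F_concdf F_strict a0_gt0 a1_gt0 a01 C_ge1
  alpha_gt0 alpha_lt1 e0.
apply: whp_sub (whp_estimates dl0) _ => m x [m0 disc_e bh_ge bh_le] uh.
have := step (null_disc (H m) (@pv m x)) (alt_disc (H m) (@pv m x)) _
  (What m x) _ _ bh_ge bh_le _.
have -> : crossing (fun u => null_disc (H m) (@pv m x)
    (fun g => alpha * u * What m x u g) + alt_disc (H m) (@pv m x)
    (fun g => alpha * u * What m x u g)) = uh.
  rewrite /uh /uhat; congr crossing; apply/funext => u.
  by rewrite (GhatE (H m)).
move=> /(_ _ _ _)[].
- by move=> t t0; split; [exact: null_disc_ge0|exact: (disc_e t t0).1].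
- by move=> t t0; split; [exact: alt_disc_ge0|exact: (disc_e t t0).2].
- move=> u u01; have [WK Wmax] := What_opt m x u01.
  by move: WK Wmax; rewrite /Khat /= ntestsE => WK Wmax; split=> // w wK;
    rewrite -!(GhatE (H m) (@pv m x) alpha (fun=> _)); have := Wmax w wK;
    rewrite !(GhatE (H m)).
- move=> low up; split=> // u w u_uh wK; apply: up => //.
  by move: wK; rewrite /Khat/= ntestsE.
Qed.

End asymptotics.

Theorem corollary5p3 (R : realType) (d : measure_display)
  (T : measurableType d) (P : probability T R)
  (G : nat) (hG : (2 <= G)%N)
  (n : nat -> 'I_G -> nat)
  (n_mono : forall g m m', (m <= m')%N -> (n m g <= n m' g)%N)
  (n_sum : forall m, (\sum_g n m g)%N = m)
  (H : forall m g, 'I_(n m g) -> bool)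
  (p : forall m g, 'I_(n m g) -> {RV P >-> R})
  (p01 : forall m g (i : 'I_(n m g)) x, 0 <= p m g i x <= 1)
  (F : 'I_G -> R -> R)
  (p_null : forall m g (i : 'I_(n m g)), H m g i = false ->
    forall A, measurable A ->
      distribution P (p m g i) A = uniform_prob (@ltr01 R) A)
  (p_alt : forall m g (i : 'I_(n m g)), H m g i = true ->
    forall t, cdf (p m g i) t = (F g t)%:E)
  (F_concave : forall g, strictly_concave01 (F g))
  (F0 : forall g, F g 0 = 0)
  (pi pi0 : 'I_G -> R)
  (pi_gt0 : forall g, 0 < pi g)
  (pi0_gt0 : forall g, 0 < pi0 g)
  (pi1_gt0 : forall g, 0 < 1 - pi0 g)
  (pi_cvg : forall g, (n m g)%:R / m%:R @[m --> \oo] --> pi g)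
  (pi0_cvg : forall g,
    (nb_null (H m) g)%:R / (n m g)%:R @[m --> \oo] --> pi0 g)
  (weak_dep_null : forall g t, 0 <= t ->
    cvg_in_probability P
      (fun m x => null_ecdf (H m) (fun g i => p m g i x) g t) (U t))
  (weak_dep_alt : forall g t, 0 <= t ->
    cvg_in_probability P
      (fun m x => alt_ecdf (H m) (fun g i => p m g i x) g t) (F g t))
  (pihat0 : nat -> 'I_G -> {RV P >-> R})
  (pihat0_01 : forall m g x, 0 < pihat0 m g x <= 1)
  (pibar0 : 'I_G -> R)
  (pibar0_ge : forall g, pi0 g <= pibar0 g)
  (pihat0_cvg : forall g,
    cvg_in_probability P (fun m x => pihat0 m g x) (pibar0 g))
  (alpha : R)
  (alpha_gt : (alpha_star pi pi0 pibar0 F < alpha%:E)%E)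
  (alpha_lt1 : alpha < 1)
  (What : nat -> T -> R -> 'I_G -> R)
  (What_opt : forall m x,
    optimal_weights alpha (fun g i => p m g i x) (fun g => pihat0 m g x)
      (What m x))
  (C : R) (C_ge1 : 1 <= C)
  (pibar0E : forall g, pibar0 g = C * pi0 g) :
  let pv m x : forall g, 'I_(n m g) -> R := fun g i => p m g i x in
  let ph m x : 'I_G -> R := fun g => pihat0 m g x in
  let addow m x := ADDOW alpha (pv m x) (What m x) in
  let abh m x := ABH alpha (pv m x) (ph m x) in
  let hzz m x := HZZ alpha (pv m x) (ph m x) in
  let pro1 m x := Pro1 alpha (pv m x) (ph m x) (What m x) in
  let pro2 m x := Pro2 alpha (pv m x) (ph m x) (What m x) in
  let what2_defined := forall m x, pihat0_mean (n m) (ph m x) < 1 in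
  (forall m, random_set (addow m)) ->
  [/\ cvgn (fun m => Pow P (H m) (addow m)),
      what2_defined -> (forall m, random_set (pro1 m)) ->
        (limn_esup (fun m => Pow P (H m) (pro1 m))
           <= limn (fun m => Pow P (H m) (addow m)))%E,
      what2_defined -> (forall m, random_set (pro2 m)) ->
        (limn_esup (fun m => Pow P (H m) (pro2 m))
           <= limn (fun m => Pow P (H m) (addow m)))%E,
      what2_defined ->
        (limn_esup (fun m => Pow P (H m) (hzz m))
           <= limn (fun m => Pow P (H m) (addow m)))%E
    & (limn_esup (fun m => Pow P (H m) (abh m))
         <= limn (fun m => Pow P (H m) (addow m)))%E].
Proof.
move=> pv ph addow abh hzz pro1 pro2 what2_defined _.
have [l /andP[l0 l1] lP] := addow_limit n_sum p01 p_alt F_concave F0 pi_gt0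
  pi0_gt0 pi1_gt0 pi_cvg pi0_cvg weak_dep_null weak_dep_alt pihat0_01 pihat0_cvg
  alpha_lt1 What_opt C_ge1 pibar0E.
have ntestsE m : ntests (n m) = m by exact: n_sum.
have ph01 m x g : 0 < ph m x g <= 1 by exact: pihat0_01.
(* Half of [e] pays for the deviation off the exceptional set, half for the probability of that set,
   where the proportion is at most [1]. *)
have upper (A : forall m, T -> {set hypothesis (n m)}) :
    (forall m x, (0 < m)%N -> exists u w,
      [/\ 0 <= u <= uhat alpha (pv m x) (What m x), Khat (n m) (ph m x) w &
          A m x = rejections alpha (pv m x) (fun=> w) u]) ->
    forall e : R, 0 < e ->
      \forall m \near \oo, (Pow P (H m) (A m) <= (l + e)%:E)%E.
  move=> Aw e e0; have e20 : 0 < e / 2 by rewrite divr_gt0.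
  have := nbhs_infty_gt 0%N; have := lP _ e20 _ e20.
  apply: filterS2 => m [B [mB PB BE]] m0.
  have le0 : 0 <= l + e / 2 by rewrite addr_ge0// ltW.
  apply: (@le_trans _ _ ((l + e / 2)%:E + P B)%E).
    apply: Pow_le; rewrite ?ntestsE// => x /BE[_ _ up].
    have [u [w [u_uh wK ->]]] := Aw m x m0.
    by rewrite -{1}(ntestsE m) (card_true_rejections _ (pv m x)); exact: up.
  have -> : l + e = l + e / 2 + e / 2 by lra.
  by rewrite [leRHS]EFinD leeD2l.
have lower (e : R) : 0 < e ->
    \forall m \near \oo, ((l - e)%:E <= Pow P (H m) (addow m))%E.
  move=> e0; have e20 : 0 < e / 2 by rewrite divr_gt0.
  have := nbhs_infty_gt 0%N; have := lP _ e20 _ e20.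
  apply: filterS2 => m [B [mB PB BE]] m0.
  have n0 : (0 < ntests (n m))%N by rewrite ntestsE.
  (* [Pow_ge] takes a nonnegative bound; in the other case nonnegativity of the power is enough. *)
  have [le0|le0] := leP (l - e / 2) 0.
    apply: (@le_trans _ _ 0%E); last exact: Pow_ge0.
    by rewrite lee_fin; lra.
  (* As [l <= 1], the factor [1 - P B] costs at most a further [e / 2]. *)
  apply: (@le_trans _ _ ((l - e / 2)%:E * (1 - P B))%E); last first.
    apply: Pow_ge => //; first exact: ltW.
    move=> x /BE[_ low _].
    by rewrite (card_true_rejections (H m) (pv m x)).
  have PBfin : P B \is a fin_num by exact: fin_num_measure.
  move: PB; rewrite -(fineK PBfin) lee_fin => PB.
  rewrite -EFinB -EFinM lee_fin.
  have : 0 <= fine (P B) by rewrite fine_ge0.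
  nra.
have uh_bounds m x w : Khat (n m) (ph m x) w ->
    0 <= uhat alpha (pv m x) (fun=> w) <= uhat alpha (pv m x) (What m x).
  move=> wK; have /andP[-> _] := uhat_itv alpha (pv m x) (fun=> w).
  exact: uhat_le_optimal (What_opt m x) wK.
have Khat1 m x : Khat (n m) (ph m x) (what1 (n m) (ph m x)).
  exact: Khat_what1.
have Khat2 m x : what2_defined -> (0 < m)%N ->
    Khat (n m) (ph m x) (what2 (n m) (ph m x)).
  by move=> def2 m0; apply: Khat_what2; rewrite ?ntestsE.
have uhM m x : what2_defined -> (0 < m)%N ->
    0 <= uhatM alpha (pv m x) (ph m x) <= uhat alpha (pv m x) (What m x).
  move=> def2 m0; have /andP[u1 u1'] := uh_bounds m x _ (Khat1 m x).
  have /andP[u2 u2'] := uh_bounds m x _ (Khat2 m x def2 m0).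
  by rewrite /uhatM le_max u1 ge_max u1' u2'.
have KhatM m x : what2_defined -> (0 < m)%N ->
    Khat (n m) (ph m x) (What m x (uhatM alpha (pv m x) (ph m x))).
  move=> def2 m0; have /andP[u0 u1] := uhM m x def2 m0.
  have /andP[_ u1'] := uhat_itv alpha (pv m x) (What m x).
  by apply: (What_opt m x _ _).1; rewrite u0 (le_trans u1).
have WBH_upper (w : forall m, T -> 'I_G -> R) :
    (forall m x, (0 < m)%N -> Khat (n m) (ph m x) (w m x)) ->
    (limn_esup (fun m => Pow P (H m) (fun x => WBH alpha (pv m x) (w m x)))
      <= l%:E)%E.
  move=> wK; apply: limn_esup_le_near; apply: upper => m x m0.
  exists (uhat alpha (pv m x) (fun=> w m x)), (w m x).
  by split; [exact/uh_bounds/wK|exact: wK|].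
have addow_cvg : (fun m => Pow P (H m) (addow m)) @ \oo --> l%:E.
  apply: cvg_of_near_le => e e0; near=> m; apply/andP; split.
    by near: m; exact: lower.
  near: m; apply: upper => // m x m0.
  have uh01 := uhat_itv alpha (pv m x) (What m x).
  exists (uhat alpha (pv m x) (What m x)).
  exists (What m x (uhat alpha (pv m x) (What m x))); split=> //.
    by rewrite lexx andbT; case/andP: uh01.
  exact: (What_opt m x _ uh01).1.
split; first exact: cvgP addow_cvg.
all: rewrite (cvg_lim _ addow_cvg)//.
- move=> def2 _; apply: limn_esup_le_near; apply: upper => m x m0.
  exists (uhatM alpha (pv m x) (ph m x)).
  by exists (What m x (uhatM alpha (pv m x) (ph m x))); split; auto.
(* Pro2 freezes the weights at [uhatM] and runs its own step-up, so it is a [WBH] with a random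
   vector of [Khat]. *)
- by move=> def2 _; apply: WBH_upper => m x m0; exact: KhatM.
- by move=> def2; apply: WBH_upper => m x m0; exact: Khat2.
- by apply: WBH_upper => m x _; exact: Khat1.
Unshelve. all: by end_near. Qed.
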